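(* Let $n\ge1$ and $0\le k\le n-1$ be integers and let $$f(q)=\frac{\binom{n-1}{k}_q\,\binom{2n-k}{n-k-1}_q}{[n-k]_q}.$$ Let the cyclic group $\mathcal{C}_2$ act on $\mathrm{Inc}^k(2\times n)$, its non-identity element acting by K-evacuation $\mathcal{E}$. Then the triple $(\mathrm{Inc}^k(2\times n),\mathcal{C}_2,f)$ exhibits the cyclic sieving phenomenon; that is, $|\mathrm{Inc}^k(2\times n)|=f(1)$ and the number of $T\in\mathrm{Inc}^k(2\times n)$ with $\mathcal{E}(T)=T$ equals $f(-1)$.
   Context: Partitions are identified with Young diagrams in English convention; $|\lambda|$ is the number of boxes; $2\times n$ is the partition $(n,n)$. An increasing tableau of shape $\lambda$ is a filling of the boxes of $\lambda$ by positive integers, strictly increasing along rows and down columns, whose set of entries is $\{1,\dots,M\}$ for some $M$ (its maximum entry). $\mathrm{Inc}^k(\lambda)$ is the set of increasing tableaux of shape $\lambda$ with maximum entry $|\lambda|-k$. K-promotion: the SE-neighbors of a box are the (at most two) boxes of the shape immediately below it or immediately to its right. For an increasing tableau $T$ with maximum entry $M$, delete the entry $1$, leaving an empty box; then repeatedly, simultaneously on all empty boxes, until no empty box has an SE-neighbor: label each empty box by the minimal label among its SE-neighbors and remove that label from the SE-neighbor(s) in which it appears (an empty box with no SE-neighbor is left unchanged). Finally label all empty boxes by $M+1$ and subtract $1$ from every label; the result is $\mathcal{P}(T)$, an increasing tableau of the same shape and maximum entry. K-evacuation: $[T]_j$ is the Young diagram of boxes of $T$ with entry $\le j$; a chain $\emptyset=\mu_0\subseteq\cdots\subseteq\mu_M$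 encodes the filling with $j$ in every box of $\mu_j\setminus\mu_{j-1}$. For $T$ with maximum entry $M$, $\mathcal{E}(T)$ is the increasing tableau encoded by the chain $([\mathcal{P}^{M-j}(T)]_j)_{0\le j\le M}$; it is an involution on $\mathrm{Inc}^k(\lambda)$. Cyclic sieving: for a finite set $X$ with an action of $\mathcal{C}_N=\langle c\rangle$ and $f$ a polynomial (or a rational function regular at the relevant roots of unity), $(X,\mathcal{C}_N,f)$ has the cyclic sieving phenomenon if for all integers $m$ the number of elements of $X$ fixed by $c^m$ equals $f(\zeta^m)$, where $\zeta$ is a primitive $N$th root of unity. Notation: $[m]_q=1+q+\cdots+q^{m-1}$, $[m]_q!=\prod_{i=1}^m[i]_q$, $\binom{a}{b}_q=[a]_q!/([b]_q![a-b]_q!)$. *)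

(* Defs.v *)
From HB Require Import structures.
From mathcomp Require Import all_boot all_order all_algebra all_field.
From mathcomp Require Import fraction finmap.

Set Implicit Arguments.
Unset Strict Implicit.
Unset Printing Implicit Defensive.

Import Order.TTheory GRing.Theory Num.Theory.

Local Open Scope nat_scope.

(* A shape is the sequence of its row lengths; rows and columns are numbered
   from 0, rows going downwards. *)
Definition box (sh : seq nat) := {i : 'I_(size sh) & 'I_(nth 0 sh i)}.

Definition brow sh (b : box sh) : nat := tag b.
Definition bcol sh (b : box sh) : nat := tagged b.

Definition filling (sh : seq nat) := {ffun box sh -> nat}.

Definition max_entry sh (T : filling sh) : nat := \max_(b : box sh) T b.

Definition row_increasing sh (T : filling sh) : bool :=
  [forall b : box sh, forall b' : box sh,
    (brow b == brow b') && (bcol b < bcol b') ==> (T b < T b')].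

Definition col_increasing sh (T : filling sh) : bool :=
  [forall b : box sh, forall b' : box sh,
    (bcol b == bcol b') && (brow b < brow b') ==> (T b < T b')].

Definition entries_initial sh (T : filling sh) : bool :=
  [forall b : box sh, 0 < T b] &&
  all (fun v => [exists b : box sh, T b == v]) (iota 1 (max_entry T)).

Definition increasing_tableau sh (T : filling sh) : bool :=
  [&& row_increasing T, col_increasing T & entries_initial T].

Definition is_Inc sh (k : nat) (T : filling sh) : bool :=
  increasing_tableau T && (max_entry T + k == #|{: box sh}|).

(* The entries of the tableaux in Inc^k(sh) are at most the number of boxes, so
   that bounded fillings suffice to enumerate them; see [mem_Inc]. *)
Definition Inc sh (k : nat) : {fset filling sh} :=
  [fset T in [seq [ffun b => val (F b)]
                | F : {ffun box sh -> 'I_(#|{: box sh}|.+1)}]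
        | is_Inc k T]%fset.

Lemma mem_Inc sh k (T : filling sh) : (T \in Inc sh k) = is_Inc k T.
Proof.
rewrite !inE /= andb_idl // => /andP[_ /eqP maxT].
have leT b : T b < #|{: box sh}|.+1.
  by rewrite ltnS -maxT (leq_trans _ (leq_addr _ _)) // leq_bigmax.
apply/mapP; exists [ffun b => Ordinal (leT b)]; first by rewrite mem_enum.
by apply/ffunP => b; rewrite !ffunE.
Qed.

(* K-promotion.  [None] marks an empty box. *)
Definition partial_filling (sh : seq nat) := {ffun box sh -> option nat}.

Definition SE_neighbor sh (b b' : box sh) : bool :=
  ((brow b' == (brow b).+1) && (bcol b' == bcol b)) ||
  ((brow b' == brow b) && (bcol b' == (bcol b).+1)).

Definition seq_min (s : seq nat) : option nat :=
  if s is x :: s' then Some (foldr minn x s') else None.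

Definition SE_min_label sh (S : partial_filling sh) (b : box sh) : option nat :=
  seq_min (pmap S [seq b' <- enum {: box sh} | SE_neighbor b b']).

Definition delete_one sh (T : filling sh) : partial_filling sh :=
  [ffun b => if T b == 1 then None else Some (T b)].

Definition promotion_step sh (S : partial_filling sh) : partial_filling sh :=
  [ffun b =>
    if S b is Some x then
      if [exists b' : box sh,
           [&& S b' == None, SE_neighbor b' b & SE_min_label S b' == Some x]]
      then None else Some x
    else SE_min_label S b].

(* A step moves every empty box that has an SE-neighbor one antidiagonal
   further and does nothing once there is no such box, so iterating as many
   times as there are boxes amounts to iterating until no empty box has an
   SE-neighbor. *)
Definition promotion_slide sh (T : filling sh) : partial_filling sh :=
  iter #|{: box sh}| (@promotion_step sh) (delete_one T).

Definition Kpromotion sh (T : filling sh) : filling sh :=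
  [ffun b => (odflt (max_entry T).+1 (promotion_slide T b)).-1].

Definition boxes_le sh (T : filling sh) (j : nat) : {set box sh} :=
  [set b | T b <= j].

Definition filling_of_chain sh (M : nat) (mu : nat -> {set box sh}) :
    filling sh :=
  [ffun b => oapp val 0
    [pick j : 'I_M.+1 | (0 < j) && (b \in mu j :\: mu j.-1)]].

Definition Kevacuation sh (T : filling sh) : filling sh :=
  filling_of_chain (max_entry T)
    (fun j => boxes_le (iter (max_entry T - j) (@Kpromotion sh) T) j).

Local Open Scope ring_scope.

Local Notation "p %:F" := (tofrac p).

(* The rational function f is regular at x, with value v there. *)
Definition has_value (f : {fraction {poly algC}}) (x v : algC) : Prop :=
  exists p d : {poly algC},
    [/\ d.[x] != 0, f = p%:F / d%:F & v = p.[x] / d.[x]].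

Definition fixed_points (A : choiceType) (X : {fset A}) (c : A -> A) :
  {fset A} := [fset x in X | c x == x]%fset.

(* The first two clauses say that c generates an action of the cyclic group of
   order N on X; an integral power of c then acts as the power of c whose
   exponent is the residue modulo N. *)
Definition cyclic_sieving (A : choiceType) (X : {fset A}) (N : nat)
    (c : A -> A) (f : {fraction {poly algC}}) : Prop :=
  [/\ forall x, x \in X -> c x \in X,
      forall x, x \in X -> iter N c x = x
    & forall (z : algC) (m : int), N.-primitive_root z ->
        has_value f (z ^ m)
          (#|` fixed_points X (iter `|(m %% N%:Z)%Z|%N c)|%:R)].

Definition qint (m : nat) : {poly algC} := \sum_(i < m) 'X^i.

Definition qfact (m : nat) : {poly algC} := \prod_(1 <= i < m.+1) qint i.

(* Only meaningful for b <= a. *)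
Definition qbinom (a b : nat) : {fraction {poly algC}} :=
  (qfact a)%:F / ((qfact b)%:F * (qfact (a - b))%:F).

Definition fnk (n k : nat) : {fraction {poly algC}} :=
  qbinom (n - 1) k * qbinom (2 * n - k) (n - k - 1) / (qint (n - k))%:F.

(* Main.v *)
Require Import Defs.
From HB Require Import structures.
From mathcomp Require Import all_boot all_order all_algebra all_field.
From mathcomp Require Import fraction finmap.
From mathcomp Require Import zify ring lra.

Set Implicit Arguments.
Unset Strict Implicit.
Unset Printing Implicit Defensive.

Import Order.TTheory GRing.Theory Num.Theory.
Local Open Scope ring_scope.

(* An increasing tableau of shape 2 x n is encoded by the word telling, for each
   value, in which of the two rows it occurs: a Motzkin-like path whose flat
   steps (values occurring in both rows) are forbidden at height 0.

   K-promotion only changes two letters: the first letter touching height 1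
   and the letter of the first return to 0.  Hence the shape formed, after i
   promotions, by the entries that were originally in ]i, l] is determined by
   two minima of the path over [i, l] ([rank_promE]); for l = M this shape
   has rows n - b(i) and n - a(i), where a(i) and b(i) count the entries at
   most i in the two rows.  Consequently K-evacuation is the rotation by 180
   degrees composed with the reversal of the alphabet, and it reverses words
   while exchanging up and down steps.

   So f(1) has to count all paths and f(-1) the symmetric ones, that is, path
   prefixes of half the length.  Both numbers have closed forms proved from the
   recurrence on the last step, while f(-1) is computed by splitting off
   the factor (1 + q)^(m/2) of [m]_q!, whose exponents cancel in f. *)

(** * Counting the entries of a row up to a bound *)

Section Rank.
Local Open Scope nat_scope.

(** Minima occur because down steps of the word on ]i, l] that have no matching up step inside ]i,
    l] are the entries that sliding lifts into the first row, and their number is the height at i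
    minus the minimum height on [i, l]. Double letters force two minima. For the growth of the first
    row they are flat steps; for the loss of the second row they count as a down step followed by an
    up step, so that the path dips inside the letter. The obstacle is that one promotion changes
    each row according to a comparison of both rows. The two formulas therefore cannot be separated,
    and both must be known for all right ends l before i can be increased. At q = -1 the quotient of
    q-factorials defining f is of the form 0/0 in general. After cancellation each [m]_q! leaves the
    factorial of the integer part of m/2, so the count of path prefixes has to be brought to the
    same quotient with halved arguments. *)

Definition row_incr (n : nat) (t : nat -> nat) :=
  forall i j, i < j -> j < n -> t i < t j.

Definition rank (n : nat) (t : nat -> nat) (l : nat) : nat :=
  count (fun c => t c <= l) (iota 0 n).

Lemma row_incr_le n t i j : row_incr n t -> i <= j -> j < n -> t i <= t j.
Proof.
move=> tI; rewrite leq_eqVlt => /orP[/eqP-> //|lt_ij] lt_jn.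
by rewrite ltnW // tI.
Qed.

Lemma rank_eq n t l A : A <= n ->
  (forall c, c < n -> (t c <= l) = (c < A)) -> rank n t l = A.
Proof.
move=> leAn tA; rewrite /rank (@eq_in_count _ _ (fun c => c < A)); last first.
  by move=> c; rewrite mem_iota add0n => /tA.
rewrite -{1}(subnKC leAn) iotaD count_cat add0n.
rewrite (@eq_in_count _ _ predT); last by move=> c; rewrite mem_iota.
rewrite [X in _ + X](@eq_in_count _ _ pred0); last first.
  by move=> c; rewrite mem_iota => /andP[leAc _] /=; rewrite ltnNge leAc.
by rewrite count_predT count_pred0 size_iota addn0.
Qed.

Lemma rank_le n t l : rank n t l <= n.
Proof. by rewrite -[X in _ <= X](size_iota 0 n) count_size. Qed.

Lemma rankP n t l c : row_incr n t -> c < n -> (c < rank n t l) = (t c <= l).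
Proof.
move=> tI; set A := find (fun c => l < t c) (iota 0 n).
have leAn : A <= n by rewrite -[X in _ <= X](size_iota 0 n) find_size.
have tA c' : c' < n -> (t c' <= l) = (c' < A).
  move=> lt_c'n; case: (ltnP c' A) => [lt_c'A|leAc'].
    have := before_find 0 lt_c'A.
    by rewrite nth_iota // add0n; move/negbT; rewrite -leqNgt.
  have ltAn : A < n by apply: leq_ltn_trans lt_c'n.
  have : has (fun c => l < t c) (iota 0 n) by rewrite has_find size_iota.
  move/(nth_find 0); rewrite -/A nth_iota // add0n => ltl.
  apply/negbTE; rewrite -ltnNge; apply: leq_trans ltl _.
  exact: (row_incr_le tI).
by move=> lt_cn; rewrite (rank_eq leAn tA) tA.
Qed.

Lemma rankS n t l : row_incr n t ->
  rank n t l.+1 = rank n t l + has (fun c => t c == l.+1) (iota 0 n).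
Proof.
move=> tI; case: hasP => [[c]|noc].
  rewrite mem_iota add0n => /= lt_cn /eqP tc.
  have E1 : rank n t l = c.
    apply: rank_eq => [|c' lt_c'n]; first exact: ltnW.
    by case: (ltngtP c' c) => [/tI|/tI|->]; lia.
  rewrite E1 addn1; apply: rank_eq => // c' lt_c'n.
  rewrite ltnS; case: (ltngtP c' c) => [/tI|/tI|->]; [lia|lia|].
  by rewrite tc leqnn.
rewrite addn0; apply: eq_in_count => c c_in /=.
rewrite [in LHS]leq_eqVlt ltnS; case: eqP => //= tc.
by case: noc; exists c => //; apply/eqP.
Qed.

Lemma rank_full n t l : (forall c, c < n -> t c <= l) -> rank n t l = n.
Proof. by move=> tl; apply: rank_eq => // c lt_cn; rewrite tl. Qed.

Lemma rank0 n t l : (forall c, c < n -> l < t c) -> rank n t l = 0.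
Proof. by move=> tl; apply: rank_eq => // c /tl; lia. Qed.

End Rank.

(** * Promotion of a two-row tableau given by its rows *)

Section TwoRows.
Local Open Scope nat_scope.

(* [t0] and [t1] are the two rows of an increasing tableau of shape 2 x n with
   maximum entry M, extended by the sentinel M.+1 in column n. *)
Record tab (n M : nat) (t0 t1 : nat -> nat) : Prop := Tab {
  tab_row0 : row_incr n.+1 t0;
  tab_row1 : row_incr n.+1 t1;
  tab_col : forall c, c < n -> t0 c < t1 c;
  tab_gt0 : forall c, c < n -> 0 < t0 c;
  tab_end0 : t0 n = M.+1;
  tab_end1 : t1 n = M.+1;
  tab_onto : forall v, 0 < v <= M ->
    (exists2 c, c < n & t0 c = v) \/ (exists2 c, c < n & t1 c = v) }.

Lemma find_iota0P (P : pred nat) n c0 : c0 < n -> P c0 ->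
  [/\ find P (iota 0 n) <= c0, P (find P (iota 0 n)) &
      forall c, c < find P (iota 0 n) -> ~~ P c].
Proof.
move=> lt_c0n Pc0; set A := find _ _.
have hasP' : has P (iota 0 n).
  by apply/hasP; exists c0; rewrite ?mem_iota.
have ltAn : A < n by rewrite -[X in _ < X](size_iota 0 n) -has_find.
have bf c : c < A -> ~~ P c.
  move=> lt_cA; have := before_find 0 lt_cA.
  by rewrite nth_iota ?add0n ?(ltn_trans lt_cA) // => ->.
have PA : P A by have := nth_find 0 hasP'; rewrite -/A nth_iota.
by split=> //; rewrite leqNgt; apply/negP => /bf; rewrite Pc0.
Qed.

(* Columns where the sliding empty box first enters, and finally moves entirely
   to, the second row. *)
Definition touch_col n (t0 t1 : nat -> nat) :=
  find (fun c => t1 c <= t0 c.+1) (iota 0 n).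
Definition drop_col n (t0 t1 : nat -> nat) :=
  find (fun c => t1 c < t0 c.+1) (iota 0 n).

(** If [touch_col] and [drop_col] differ, the empty box splits on a tie at the first one; from there
    an empty box runs in each row until the upper one drops. *)
Definition slide0 n (t0 t1 : nat -> nat) c :=
  let e := drop_col n t0 t1 in
  if c < e then t0 c.+1 else if c == e then t1 c else t0 c.
Definition slide1 n (t0 t1 : nat -> nat) c :=
  if c < touch_col n t0 t1 then t1 c else t1 c.+1.

Definition promote n (t : (nat -> nat) * (nat -> nat)) :=
  (fun c => if c < n then (slide0 n t.1 t.2 c).-1 else t.1 c,
   fun c => if c < n then (slide1 n t.1 t.2 c).-1 else t.2 c).

Section Tableau.
Variables (n M : nat) (t0 t1 : nat -> nat).
Hypotheses (n_gt0 : 0 < n) (tT : tab n M t0 t1).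

Let d := touch_col n t0 t1.
Let e := drop_col n t0 t1.

Lemma row_incr0 : row_incr n t0.
Proof. by move=> i j lt_ij lt_jn; apply: (tab_row0 tT) => //; apply: ltnW. Qed.

Lemma row_incr1 : row_incr n t1.
Proof. by move=> i j lt_ij lt_jn; apply: (tab_row1 tT) => //; apply: ltnW. Qed.

Lemma tab_le0 c : c < n -> t0 c <= M.
Proof. by move=> lt_cn; have := tab_row0 tT lt_cn (ltnSn n); rewrite (tab_end0 tT). Qed.

Lemma tab_le1 c : c < n -> t1 c <= M.
Proof. by move=> lt_cn; have := tab_row1 tT lt_cn (ltnSn n); rewrite (tab_end1 tT). Qed.

Lemma tab_M_gt1 : 1 < M.
Proof. by have := tab_le1 n_gt0; have := tab_col tT n_gt0; have := tab_gt0 tT n_gt0; lia. Qed.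

Lemma tab_first : t0 0 = 1.
Proof.
have M1 := tab_M_gt1.
have [|[c lt_cn tc]|[c lt_cn tc]] := @tab_onto _ _ _ _ tT 1; first lia.
  by have := row_incr_le row_incr0 (leq0n c) lt_cn; have := tab_gt0 tT n_gt0; lia.
by have := tab_col tT lt_cn; have := tab_gt0 tT lt_cn; lia.
Qed.

Lemma tab_last : t1 n.-1 = M.
Proof.
have M1 := tab_M_gt1.
have [|[c lt_cn tc]|[c lt_cn tc]] := @tab_onto _ _ _ _ tT M; first lia.
  by have := tab_le1 lt_cn; have := tab_col tT lt_cn; lia.
have lt_n1n : n.-1 < n by lia.
have := @row_incr_le n t1 c n.-1 row_incr1 _ lt_n1n; have := tab_le1 lt_n1n; lia.
Qed.

Lemma drop_colP : [/\ e < n, t1 e < t0 e.+1 &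
  forall c, c < e -> t0 c.+1 <= t1 c].
Proof.
have lt_n1n : n.-1 < n by lia.
(* The sentinel makes the search succeed at the last column: [t1 n.-1 <= M < t0 n]. *)
have := @find_iota0P (fun c => t1 c < t0 c.+1) n n.-1 lt_n1n.
rewrite prednK // (tab_end0 tT) ltnS tab_le1 // => /(_ isT)[le_e Pe bf].
split=> //; first exact: leq_ltn_trans le_e _.
by move=> c /bf; rewrite -leqNgt.
Qed.

Lemma touch_colP : [/\ d <= e, t1 d <= t0 d.+1 &
  forall c, c < d -> t0 c.+1 < t1 c].
Proof.
have [lt_en te _] := drop_colP.
have [le_de Pd bf] :=
  @find_iota0P (fun c => t1 c <= t0 c.+1) n e lt_en (ltnW te).
by split=> // c /bf; rewrite -ltnNge.
Qed.

Lemma slide0_eq c : slide0 n t0 t1 c =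
  if c < e then t0 c.+1 else if c == e then t1 c else t0 c.
Proof. by []. Qed.

Lemma slide1_eq c : slide1 n t0 t1 c = if c < d then t1 c else t1 c.+1.
Proof. by []. Qed.

Lemma slide0_gt1 c : c < n -> 1 < slide0 n t0 t1 c.
Proof.
move=> lt_cn; rewrite slide0_eq; have [lt_en _ _] := drop_colP.
have F := tab_first; have C := tab_col tT lt_cn; have G := tab_gt0 tT lt_cn.
case: (ltngtP c e) => [lt_ce|lt_ec|_]; last by lia.
  by have := @row_incr0 0 c.+1 isT; lia.
by have := @row_incr0 0 c; lia.
Qed.

Lemma slide1_gt1 c : c < n -> 1 < slide1 n t0 t1 c.
Proof.
move=> lt_cn; rewrite slide1_eq.
have C := tab_col tT lt_cn; have G := tab_gt0 tT lt_cn.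
by have := @tab_row1 _ _ _ _ tT c c.+1 (ltnSn _); case: ifP; lia.
Qed.

Lemma slide0_lt i j : i < j -> j < n -> slide0 n t0 t1 i < slide0 n t0 t1 j.
Proof.
move=> lt_ij lt_jn; rewrite !slide0_eq; have [lt_en te be] := drop_colP.
have lt_in := ltn_trans lt_ij lt_jn.
have I0 a b := @row_incr0 a b; have J0 a b := @row_incr_le n t0 a b row_incr0.
have K1 := tab_col tT lt_in; have K2 := tab_col tT lt_jn.
case: (ltngtP i e) => [lt_ie|lt_ei|E]; case: (ltngtP j e) => [lt_je|lt_ej|E']; try lia.
- by apply: I0; lia.
- by apply: leq_ltn_trans (be _ lt_ie) _; have := @row_incr1 i e; have := J0 e.+1 j; lia.
- by apply: leq_ltn_trans (be _ lt_ie) _; apply: row_incr1; lia.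
- by apply: I0.
- by rewrite E; apply: leq_trans te _; apply: J0; lia.
Qed.

Lemma slide1_lt i j : i < j -> j < n -> slide1 n t0 t1 i < slide1 n t0 t1 j.
Proof.
move=> lt_ij lt_jn; rewrite !slide1_eq.
have I0 a b := @tab_row1 _ _ _ _ tT a b.
by do 2![case: ifP => ?]; try lia; apply: I0; lia.
Qed.

Lemma slide_col c : c < n -> slide0 n t0 t1 c < slide1 n t0 t1 c.
Proof.
move=> lt_cn; rewrite slide0_eq slide1_eq.
have [lt_en te be] := drop_colP; have [le_de td bd] := touch_colP.
have C := tab_col tT lt_cn; have I0 a b := @tab_row1 _ _ _ _ tT a b.
have I1 := I0 c c.+1 (ltnSn _).
case: (ltngtP c e) => [lt_ce|lt_ec|E]; case: ifP => [lt_cd|ge_cd]; try lia.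
- exact: bd.
- by apply: leq_ltn_trans (be _ lt_ce) _; apply: I1.
Qed.

Lemma slide_le c : c < n -> slide1 n t0 t1 c <= M.+1.
Proof.
move=> lt_cn; rewrite slide1_eq; have := tab_le1 lt_cn.
case: ifP => _; first lia.
have := @row_incr_le n.+1 t1 c.+1 n (tab_row1 tT).
by rewrite (tab_end1 tT); lia.
Qed.

Lemma slide1_last : slide1 n t0 t1 n.-1 = M.+1.
Proof.
have [lt_en te be] := drop_colP; have [le_de td bd] := touch_colP.
rewrite slide1_eq ifF ?prednK ?(tab_end1 tT) //; lia.
Qed.

Lemma tab_promote : tab n M (promote n (t0, t1)).1 (promote n (t0, t1)).2.
Proof.
rewrite /=; have [lt_en te be] := drop_colP; have [le_de td bd] := touch_colP.
split.
- move=> i j lt_ij; rewrite ltnS => le_jn; rewrite ifT; last by lia.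
  case: ifP => [lt_jn|ge_jn].
    by have := slide0_lt lt_ij lt_jn; have := @slide0_gt1 i; lia.
  have -> : j = n by lia.
  rewrite (tab_end0 tT).
  by have := @slide_col i; have := @slide_le i; lia.
- move=> i j lt_ij; rewrite ltnS => le_jn; rewrite ifT; last by lia.
  case: ifP => [lt_jn|ge_jn].
    by have := slide1_lt lt_ij lt_jn; have := @slide1_gt1 i; lia.
  have -> : j = n by lia.
  rewrite (tab_end1 tT).
  by have := @slide_col i; have := @slide_le i; lia.
- move=> c lt_cn; rewrite lt_cn.
  by have := slide_col lt_cn; have := slide0_gt1 lt_cn; lia.
- by move=> c lt_cn; rewrite lt_cn; have := slide0_gt1 lt_cn; lia.
- by rewrite ltnn (tab_end0 tT).
- by rewrite ltnn (tab_end1 tT).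
move=> v /andP[v_gt0 le_vM].
have H0 c : c < n -> slide0 n t0 t1 c = v.+1 ->
    exists2 c, c < n & (if c < n then (slide0 n t0 t1 c).-1 else t0 c) = v.
  by move=> lt_cn E; exists c => //; rewrite lt_cn E.
have H1 c : c < n -> slide1 n t0 t1 c = v.+1 ->
    exists2 c, c < n & (if c < n then (slide1 n t0 t1 c).-1 else t1 c) = v.
  by move=> lt_cn E; exists c => //; rewrite lt_cn E.
move: le_vM; rewrite leq_eqVlt => /orP[/eqP E|lt_vM].
  by right; apply: (H1 n.-1); rewrite ?slide1_last ?E //; lia.
have [|[c lt_cn tc]|[c lt_cn tc]] := @tab_onto _ _ _ _ tT v.+1; first lia.
  left; case: (ltnP e c) => [lt_ec|le_ce].
    by apply: (H0 c) => //; rewrite slide0_eq; case: ltngtP lt_ec.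
  case: c lt_cn tc le_ce => [|c] lt_cn tc le_ce.
    by move: tc; rewrite tab_first; lia.
  by apply: (H0 c); [lia | rewrite slide0_eq ifT].
case: (ltngtP c d) => [lt_cd|lt_dc|E].
- by right; apply: (H1 c) => //; rewrite slide1_eq lt_cd.
- right; case: c lt_cn tc lt_dc => // c lt_cn tc le_dc.
  by apply: (H1 c); [lia | rewrite slide1_eq ifF //; lia].
(* Only [t1 d] leaves the second row. It moves up if [d = e]; otherwise there is a tie and it
   survives as [t0 d.+1]. *)
- subst c; left; move: le_de; rewrite leq_eqVlt => /orP[/eqP E|lt_de].
    by apply: (H0 d) => //; rewrite slide0_eq -E ltnn eqxx.
  apply: (H0 d) => //; rewrite slide0_eq lt_de; have := be _ lt_de; lia.
Qed.

(** The first row loses the entry 1 and gains [t1 e]; then every label drops by 1. *)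
Lemma rank_promote0 l : l < M ->
  rank n (promote n (t0, t1)).1 l + 1 = rank n t0 l.+1 + (t1 e <= l.+1).
Proof.
move=> lt_lM; have [lt_en te be] := drop_colP.
have RP c := @rankP n t0 l.+1 c row_incr0.
have Rn := rank_le n t0 l.+1.
have F : 0 < rank n t0 l.+1 by rewrite RP // tab_first.
suff -> : rank n (promote n (t0, t1)).1 l =
    rank n t0 l.+1 + (t1 e <= l.+1) - 1 by lia.
have Ln : t1 e <= l.+1 \/ rank n t0 l.+1 <= e.+1.
  case: (leqP (t1 e) l.+1) => H; first by left.
  right; rewrite leqNgt; apply/negP => H'.
  have lt : e.+1 < n by lia.
  by move: (RP e.+1 lt); lia.
apply: rank_eq; first by lia.
move=> c lt_cn /=; rewrite lt_cn.
have := slide0_gt1 lt_cn; rewrite slide0_eq.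
case: (ltngtP c e) => [lt_ce|lt_ec|E] G.
- have := RP c.+1; have := RP e lt_en; have := tab_col tT lt_en; lia.
- have := RP c lt_cn; have := @row_incr_le n t0 e.+1 c row_incr0 lt_ec lt_cn; lia.
- have := RP c lt_cn; have := RP c.+1; have := tab_col tT lt_cn.
  rewrite E; lia.
Qed.

(** The second row loses [t1 d], and the label gained at its end exceeds the bound since [l < M]. *)
Lemma rank_promote1 l : l < M ->
  rank n (promote n (t0, t1)).2 l + (t1 d <= l.+1) = rank n t1 l.+1.
Proof.
move=> lt_lM; have [lt_en te be] := drop_colP; have [le_de td bd] := touch_colP.
have lt_dn : d < n by lia.
have RP c := @rankP n t1 l.+1 c row_incr1.
have Rn := rank_le n t1 l.+1.
have Rd := RP d lt_dn.
suff -> : rank n (promote n (t0, t1)).2 l =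
    rank n t1 l.+1 - (t1 d <= l.+1) by lia.
apply: rank_eq; first by lia.
move=> c lt_cn /=; rewrite lt_cn.
have := slide1_gt1 lt_cn; rewrite slide1_eq.
have Rc := RP c lt_cn.
case: ifP => [lt_cd|ge_cd] G.
- have := row_incr1 lt_cd lt_dn; lia.
- have := @row_incr_le n t1 d c row_incr1 _ lt_cn.
  have := RP c.+1; have := @tab_end1 _ _ _ _ tT.
  case: (ltnP c.+1 n) => [|le_nc]; first by lia.
  by have -> : c.+1 = n by [lia]; lia.
Qed.

(** The value [t1 e] is the first return of the path to 0. When it is read, column [e] is complete
    and column [e.+1] is not begun; conversely, at height 0 the last column [q] reached satisfies
    [t1 q < t0 q.+1], so [e <= q]. *)
Lemma drop_rankP l : l <= M ->
  (t1 e <= l) = has (fun t => rank n t0 t <= rank n t1 t) (iota 1 l).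
Proof.
move=> le_lM; have [lt_en te be] := drop_colP.
have RP0 l c := @rankP n t0 l c row_incr0.
have RP1 l c := @rankP n t1 l c row_incr1.
have Rn0 := rank_le n t0; have Rn1 := rank_le n t1.
apply/idP/hasP => [le_el|[t]].
  exists (t1 e); first by rewrite mem_iota; have := tab_col tT lt_en; lia.
  have := RP1 (t1 e) e lt_en; rewrite leqnn => H; apply: leq_trans H.
  rewrite leqNgt; apply/negP => H.
  by have := RP0 (t1 e) e.+1; have := Rn0 (t1 e); lia.
rewrite mem_iota => t_in le_rank.
have F : 0 < rank n t0 t by rewrite RP0 // tab_first //; lia.
set q := (rank n t1 t).-1.
have lt_qn : q < n by have := Rn1 t; lia.
have tq : t1 q <= t by rewrite -RP1 //; lia.
have tq1 : t < t0 q.+1.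
  case: (ltnP q.+1 n) => [lt_q1n|le_nq1].
    by rewrite ltnNge -RP0 //; lia.
  by have -> : q.+1 = n by [lia]; rewrite (tab_end0 tT); lia.
have le_eq : e <= q.
  by rewrite leqNgt; apply/negP => /be; lia.
by have := @row_incr_le n t1 e q row_incr1 le_eq lt_qn; lia.
Qed.

Lemma touch_rankP l : l <= M ->
  (t1 d <= l) = has (fun t => rank n t0 t <= rank n t1 t.+1) (iota 1 l.-1).
Proof.
move=> le_lM; have [lt_en te be] := drop_colP; have [le_de td bd] := touch_colP.
have lt_dn : d < n by lia.
have RP0 l c := @rankP n t0 l c row_incr0.
have RP1 l c := @rankP n t1 l c row_incr1.
have Rn0 := rank_le n t0; have Rn1 := rank_le n t1.
have td2 : 1 < t1 d.
  by have := tab_col tT lt_dn; have := tab_gt0 tT lt_dn; lia.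
apply/idP/hasP => [le_dl|[t]].
  (* One less than [t1 d]: on a tie, [t0 d.+1 = t1 d] must not be counted in the first row. *)
  exists (t1 d).-1; first by rewrite mem_iota; lia.
  have := RP1 (t1 d) d lt_dn; rewrite leqnn => H.
  rewrite prednK; last by lia.
  apply: leq_trans H; rewrite leqNgt; apply/negP => H.
  by have := RP0 (t1 d).-1 d.+1; have := Rn0 (t1 d).-1; lia.
rewrite mem_iota => t_in le_rank.
have F : 0 < rank n t0 t by rewrite RP0 // tab_first //; lia.
set q := (rank n t1 t.+1).-1.
have lt_qn : q < n by have := Rn1 t.+1; lia.
have tq : t1 q <= t.+1 by rewrite -RP1 //; lia.
have tq1 : t < t0 q.+1.
  case: (ltnP q.+1 n) => [lt_q1n|le_nq1].
    by rewrite ltnNge -RP0 //; lia.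
  by have -> : q.+1 = n by [lia]; rewrite (tab_end0 tT); lia.
have le_dq : d <= q.
  by rewrite leqNgt; apply/negP => /bd; lia.
by have := @row_incr_le n t1 d q row_incr1 le_dq lt_qn; lia.
Qed.

Lemma tab_rank_le l : rank n t1 l <= rank n t0 l.
Proof.
rewrite leqNgt; apply/negP => H; have Rn1 := rank_le n t1 l.
have lt_qn : rank n t0 l < n by lia.
have := @rankP n t1 l _ row_incr1 lt_qn; have := @rankP n t0 l _ row_incr0 lt_qn.
by have := tab_col tT lt_qn; lia.
Qed.

(** Above an entry at most [l.+1] stands one at most [l]. On words: a down or double letter needs
    positive height. *)
Lemma tab_rank_leS l : rank n t1 l.+1 <= rank n t0 l.
Proof.
rewrite leqNgt; apply/negP => H; have Rn1 := rank_le n t1 l.+1.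
have lt_qn : rank n t0 l < n by lia.
have := @rankP n t1 l.+1 _ row_incr1 lt_qn; have := @rankP n t0 l _ row_incr0 lt_qn.
by have := tab_col tT lt_qn; lia.
Qed.

Lemma tab_rankS l : l < M -> exists x y : bool,
  [/\ rank n t0 l.+1 = rank n t0 l + x, rank n t1 l.+1 = rank n t1 l + y & x || y].
Proof.
move=> lt_lM; do 2!eexists.
split; [exact: (rankS _ row_incr0) | exact: (rankS _ row_incr1) |].
have [|[c lt_cn tc]|[c lt_cn tc]] := @tab_onto _ _ _ _ tT l.+1; first lia.
  by apply/orP; left; apply/hasP; exists c; rewrite ?mem_iota ?tc.
by apply/orP; right; apply/hasP; exists c; rewrite ?mem_iota ?tc.
Qed.

Lemma tab_rank_end l : M <= l -> rank n t0 l = n /\ rank n t1 l = n.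
Proof.
move=> le_Ml; split; apply: rank_full => c lt_cn.
  by have := tab_le0 lt_cn; lia.
by have := tab_le1 lt_cn; lia.
Qed.

Lemma tab_rank0 : rank n t0 0 = 0 /\ rank n t1 0 = 0.
Proof.
split; apply: rank0 => c lt_cn; first exact: (tab_gt0 tT).
by have := tab_col tT lt_cn; lia.
Qed.

End Tableau.

(** The arithmetic of [min_step]. [H], [K], [K1] are the heights at [i], [l], [l.+1]; [m], [u] are
    [hmin], [tmin] from [i] to [l], and [m'], [u'] those from [i.+1]; [c0], [c1] are the terms of
    [tmin] for the letters [(x, y)] of [i.+1] and [(x', y')] of [l.+1]. *)
Lemma min_step_arith (x y x' y' Xl Yl : bool) H K K1 m m' u u' c0 c1 :
  x || y -> x' || y' -> K1 + y' = K + x' -> c1 + y' = K.+1 -> y' <= K ->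
  c0 + y = H.+1 -> y <= H ->
  m' + y <= H + x -> m = minn H m' -> u = minn c0 u' ->
  m' + y + Yl = m + 1 -> u' + Xl = u + x ->
  m <= K -> m <= u <= m.+1 -> m' <= K -> m' <= u' <= m'.+1 ->
  minn m' K1 + y + (Yl || (K1 + H + 1 <= minn m K1 + minn u c1)) =
    minn m K1 + 1 /\
  minn u' c1 + (Xl || (c1 + H <= m + minn u c1)) = minn u c1 + x.
Proof.
by case: x; case: y => // _; case: x'; case: y' => // _; case: Xl; case: Yl;
  rewrite ?orTb ?orFb => *; split; lia.
Qed.

(** * Shapes after several promotions, as minima of the path *)

Section Iterate.
Variables (n M : nat) (t0 t1 : nat -> nat).
Hypotheses (n_gt0 : 0 < n) (tT : tab n M t0 t1).

Let a := rank n t0.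
Let b := rank n t1.
Let h l := a l - b l.

Definition prom i := iter i (promote n) (t0, t1).

Lemma tab_prom i : tab n M (prom i).1 (prom i).2.
Proof.
elim: i => [|i IHi] //=; have := tab_promote n_gt0 IHi.
by rewrite -surjective_pairing.
Qed.

(* The number of entries between i.+1 and l in either row after i promotions,
   i.e. the shape of the rectification of the part of the tableau with entries
   in that interval. *)
Let ai i l := rank n (prom i).1 (l - i).
Let bi i l := rank n (prom i).2 (l - i).

Fixpoint hmin i j := if j is j'.+1 then minn (hmin i j') (h (i + j)) else h i.
(** One more than the minimum of the path on [i, i + j] when each double letter is a down step
    followed by an up step: [a l - b l.+1] is the height after the down half of the letter of
    [l.+1]. *)
Fixpoint tmin i j :=
  if j is j'.+1 then minn (tmin i j') (a (i + j') + 1 - b (i + j)) else (h i).+1.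

(** By [drop_rankP] and [touch_rankP], [Y] tells whether the first row gains an entry from the
    interval in the next promotion, and [X] whether the second row loses one. *)
Let Y i l := has (fun t => ai i t <= bi i t) (iota i.+1 (l - i)).
Let X i l := has (fun t => ai i t <= bi i t.+1) (iota i.+1 (l - i.+1)).

Lemma ai_rec i l : i < l <= M -> ai i.+1 l + 1 = ai i l + Y i l.
Proof.
move=> /andP[lt_il le_lM]; have tP := tab_prom i.
have := @rank_promote0 n M _ _ n_gt0 tP (l - i.+1).
rewrite -surjective_pairing.
have -> : (l - i.+1).+1 = l - i by lia.
have lt : l - i <= M by lia.
move/(_ lt); rewrite /ai /= => ->; congr (_ + nat_of_bool _).
rewrite (drop_rankP n_gt0 tP); last by lia.
rewrite /Y -[i.+1]addn1 iotaDl has_map; apply: eq_has => t /=.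
by rewrite /ai /bi addKn.
Qed.

Lemma bi_rec i l : i < l <= M -> bi i.+1 l + X i l = bi i l.
Proof.
move=> /andP[lt_il le_lM]; have tP := tab_prom i.
have := @rank_promote1 n M _ _ n_gt0 tP (l - i.+1).
rewrite -surjective_pairing.
have -> : (l - i.+1).+1 = l - i by lia.
have lt : l - i <= M by lia.
move/(_ lt); rewrite /bi /= => <-; congr (_ + nat_of_bool _).
rewrite (touch_rankP n_gt0 tP); last by lia.
rewrite /X -[X in iota X _]addn1 iotaDl has_map subnS; apply: eq_has => t /=.
by rewrite /ai /bi -addnS !addKn.
Qed.

Lemma Y_rec i l : i <= l -> Y i l.+1 = Y i l || (ai i l.+1 <= bi i l.+1).
Proof.
move=> le_il; rewrite /Y subSn // -[X in iota _ X]addn1 iotaD has_cat /= orbF.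
by have -> : i.+1 + (l - i) = l.+1 by lia.
Qed.

Lemma X_rec i l : i < l -> X i l.+1 = X i l || (ai i l <= bi i l.+1).
Proof.
move=> lt_il; rewrite /X subSS.
have -> : l - i = (l - i.+1).+1 by lia.
rewrite -[X in iota _ X]addn1 iotaD has_cat /= orbF.
by have -> : i.+1 + (l - i.+1) = l by lia.
Qed.

Lemma hmin_le i j : hmin i j <= h i.
Proof. by elim: j => //= j IHj; rewrite geq_min IHj. Qed.

Lemma hminE i j : hmin i j.+1 = minn (h i) (hmin i.+1 j).
Proof.
elim: j => [|j IHj]; first by rewrite /= addn1.
by rewrite [LHS]/= -/(hmin i j.+1) IHj /= minnA addSnnS.
Qed.

Lemma tmin_hmin i j : i + j <= M ->
  [/\ hmin i j <= h (i + j), hmin i j <= tmin i j & tmin i j <= (hmin i j).+1].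
Proof.
elim: j => [|j IHj] le_ijM; first by rewrite /= addn0; split; lia.
rewrite addnS in le_ijM; have [H1 H2 H3] := IHj (ltnW le_ijM).
rewrite /= addnS; have [x [y [E1 E2 xy]]] := tab_rankS n_gt0 tT le_ijM.
have L1 := tab_rank_le n_gt0 tT (i + j); have L2 := tab_rank_leS n_gt0 tT (i + j).
have L3 := tab_rank_le n_gt0 tT (i + j).+1.
by move: H1 H2 H3 xy; rewrite /h /a /b E1 E2 in L1 L2 L3 *; case: x E1 L3; case: y E2 L2; split; lia.
Qed.

Lemma tminE i j : i + j < M ->
  tmin i j.+1 = minn (minn (h i).+1 (a i + 1 - b i.+1)) (tmin i.+1 j).
Proof.
elim: j => [|j IHj] lt_ijM.
  rewrite /= addn0 !addn1; rewrite addn0 in lt_ijM.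
  have [x [y [E1 E2 xy]]] := tab_rankS n_gt0 tT lt_ijM.
  have L1 := tab_rank_le n_gt0 tT i; have L2 := tab_rank_leS n_gt0 tT i.
  by move: xy; rewrite /h /a /b E1 E2 in L2 *; case: x E1; case: y E2 L2; lia.
rewrite [LHS]/= -/(tmin i j.+1) IHj /=; last by lia.
by rewrite minnA !addSnnS.
Qed.

Section Step.
Variable i : nat.
Hypotheses (lt_iM : i < M)
  (aiE : forall j, i + j <= M -> ai i (i + j) + b i + hmin i j = a (i + j))
  (biE : forall j, i + j <= M -> bi i (i + j) + a i + 1 = b (i + j) + tmin i j).

(** Moving the left end of the interval changes the minima exactly as [Y] and [X] change the shape.
    The induction extends the right end, where [Y] and [X] acquire one new test each. *)
Lemma min_step j : i.+1 + j <= M ->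
  hmin i.+1 j + b i.+1 + Y i (i.+1 + j) = hmin i j.+1 + b i + 1 /\
  tmin i.+1 j + a i + X i (i.+1 + j) = tmin i j.+1 + a i.+1.
Proof.
have [x [y [E1 E2 xy]]] := tab_rankS n_gt0 tT lt_iM.
have L1 := tab_rank_le n_gt0 tT i; have L2 := tab_rank_leS n_gt0 tT i.
have L3 := tab_rank_le n_gt0 tT i.+1.
elim: j => [|j IHj] le_M.
  rewrite addn0 in le_M *.
  have := aiE (j := 1); have := biE (j := 1); rewrite addn1 => B A.
  have -> : X i i.+1 = false by rewrite /X subnn.
  rewrite Y_rec // {1}/Y subnn /= addn0 !addn1.
  move: (A le_M) (B le_M) xy; rewrite /= addn0 !addn1 /h /a /b.
  by rewrite E1 E2 in L2 L3 *; case: x E1 L3; case: y E2 L2; split; lia.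
rewrite addnS in le_M; have [IH1 IH2] := IHj (ltnW le_M).
set l := i.+1 + j in le_M IH1 IH2 *.
have [x' [y' [E1' E2' xy']]] := tab_rankS n_gt0 tT le_M.
have El : i + j.+1 = l by rewrite /l; lia.
have El1 : i + j.+2 = l.+1 by rewrite /l; lia.
have Al := aiE (j := j.+1); have Al1 := aiE (j := j.+2).
have Bl1 := biE (j := j.+2).
rewrite El in Al; rewrite El1 in Al1 Bl1.
move/(_ (ltnW le_M)) in Al; move/(_ le_M) in Al1; move/(_ le_M) in Bl1.
have lt_il : i < l by rewrite /l; lia.
rewrite addnS -/l (Y_rec (ltnW lt_il)) (X_rec lt_il).
have L1' := tab_rank_le n_gt0 tT l; have L2' := tab_rank_leS n_gt0 tT l.
have L3' := tab_rank_le n_gt0 tT l.+1.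
have M0 := hmin_le i.+1 j; have M1 := hminE i j; have lt1 : i + j < M by rewrite /l in le_M; lia.
have M2 := tminE lt1.
have [|H1 H2 H3] := @tmin_hmin i j.+1; first by rewrite El ltnW.
have [|H1' H2' H3'] := @tmin_hmin i.+1 j; first exact: ltnW.
rewrite El in H1; rewrite -/l in H1'.
have R1 : hmin i.+1 j.+1 = minn (hmin i.+1 j) (h l.+1) by rewrite [LHS]/= addnS.
have R2 : hmin i j.+2 = minn (hmin i j.+1) (h l.+1).
  by rewrite -El1.
have R3 : tmin i.+1 j.+1 = minn (tmin i.+1 j) (a l + 1 - b l.+1).
  by rewrite -[l.+1]addnS.
have R4 : tmin i j.+2 = minn (tmin i j.+1) (a l + 1 - b l.+1).
  by rewrite -El1 -El.
have Q1 : h l.+1 + y' = h l + x' by rewrite /h /a /b; clear -E1' E2' L1' L3'; lia.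
have Q2 : a l + 1 - b l.+1 + y' = (h l).+1 by rewrite /h /a /b; clear -E2' L1' L2'; lia.
have Q3 : y' <= h l by rewrite /h /a /b; clear -E2' L1' L2'; lia.
have Q4 : a i + 1 - b i.+1 + y = (h i).+1 by rewrite /h /a /b; clear -E2 L1 L2; lia.
have Q5 : y <= h i by rewrite /h /a /b; clear -E2 L1 L2; lia.
have Q6 : hmin i.+1 j + y <= h i + x.
  by move: M0; rewrite /h /a /b; clear -E1 E2 L1 L3; lia.
have Q7 : tmin i j.+1 = minn (a i + 1 - b i.+1) (tmin i.+1 j).
  by rewrite M2; congr (minn _ _); clear -Q4; lia.
have Q8 : hmin i.+1 j + y + Y i l = hmin i j.+1 + 1.
  by move: IH1; rewrite /b E2 -/(b i); clear; lia.
have Q9 : tmin i.+1 j + X i l = tmin i j.+1 + x.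
  by move: IH2; rewrite /a E1 -/(a i); clear; lia.
have Q10 : hmin i j.+1 <= tmin i j.+1 <= (hmin i j.+1).+1 by rewrite H2.
have Q11 : hmin i.+1 j <= tmin i.+1 j <= (hmin i.+1 j).+1 by rewrite H2'.
have [] := min_step_arith xy xy' Q1 Q2 Q3 Q4 Q5 Q6 M1 Q7 Q8 Q9 H1 Q10 H1' Q11.
rewrite -R1 -R2 -R3 -R4.
(* [aiE] and [biE] turn the new tests of [Y] and [X] into comparisons of minima. *)
have -> : (h l.+1 + h i + 1 <= hmin i j.+2 + tmin i j.+2) =
    (ai i l.+1 <= bi i l.+1).
  by move: Al1 Bl1; rewrite /h /a /b; clear -L1 L3'; lia.
have -> : (a l + 1 - b l.+1 + h i <= hmin i j.+1 + tmin i j.+2) =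
    (ai i l <= bi i l.+1).
  by move: Al Bl1; rewrite /h /a /b; clear -L1 L2'; lia.
by rewrite {1}/b E2 {2}/a E1 -/(b i) -/(a i); clear; lia.
Qed.

End Step.

(** Freed of subtractions: the first row keeps [a (i + j) - a i] entries and gains [h i - hmin i j];
    the second loses [h i + 1 - tmin i j] of its [b (i + j) - b i]. *)
Lemma rank_promE i j : i + j <= M ->
  ai i (i + j) + b i + hmin i j = a (i + j) /\
  bi i (i + j) + a i + 1 = b (i + j) + tmin i j.
Proof.
have [a0 b0] := tab_rank0 n_gt0 tT.
elim: i j => [|i IHi] j le_M.
  have -> : hmin 0 j = 0.
    by elim: {le_M} j => [|j IHj]; rewrite /= ?IHj ?min0n // /h /a /b a0 b0.
  have -> : tmin 0 j = 1.
    elim: {le_M} j => [|j IHj]; rewrite /= ?IHj /h /a /b ?a0 ?b0 //.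
    by have := tab_rank_leS n_gt0 tT j; rewrite !add0n; lia.
  by rewrite /ai /bi /= subn0 /a /b a0 b0 !addn0.
have lt_iM : i < M by lia.
have [H1 H2] := @min_step i lt_iM
  (fun j' H => proj1 (IHi j' H)) (fun j' H => proj2 (IHi j' H)) j le_M.
have [|IH1 IH2] := IHi j.+1; first by lia.
have E : i + j.+1 = i.+1 + j by lia.
rewrite E in IH1 IH2.
have := @ai_rec i (i.+1 + j); have := @bi_rec i (i.+1 + j); lia.
Qed.

(** The path ends at height 0 and never goes lower, so [hmin] is 0 and [tmin] is 1, whatever happens
    between [i] and [M]. *)
Lemma rank_prom_end i : i <= M ->
  rank n (prom i).1 (M - i) = n - b i /\ rank n (prom i).2 (M - i) = n - a i.
Proof.
move=> le_iM; have := @rank_promE i (M - i); rewrite subnKC // /ai /bi.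
move=> /(_ (leqnn _))[]; have [aM bM] := tab_rank_end n_gt0 tT (leqnn M).
have hM : h M = 0 by rewrite /h /a /b aM bM subnn.
have [|H1 H2 H3] := @tmin_hmin i (M - i); first by rewrite subnKC.
rewrite subnKC // hM in H1.
have -> : hmin i (M - i) = 0 by lia.
suff -> : tmin i (M - i) = 1 by rewrite /a /b aM bM; lia.
suff : 0 < tmin i (M - i) by lia.
elim: (M - i) => //= j IHj; rewrite leq_min IHj /=.
by have := tab_rank_leS n_gt0 tT (i + j); rewrite -addnS /a /b; lia.
Qed.

End Iterate.
End TwoRows.

(** * From fillings of boxes to pairs of rows *)

Section Boxes.
Local Open Scope nat_scope.
Variable n : nat.

(** The column bound [nth 0 [:: n; n] i] reduces to [n] only for a concrete row, hence the case
    split outside the pair. *)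
Definition bx (r : bool) (c : 'I_n) : box [:: n; n] :=
  if r then existT (fun i : 'I_2 => 'I_(nth 0 [:: n; n] i)) (@Ordinal 2 1 isT) c
  else existT (fun i : 'I_2 => 'I_(nth 0 [:: n; n] i)) (@Ordinal 2 0 isT) c.

Lemma brow_bx r c : brow (bx r c) = r.
Proof. by case: r. Qed.

Lemma bcol_bx r c : bcol (bx r c) = c.
Proof. by case: r. Qed.

Lemma bx_ind (P : box [:: n; n] -> Prop) :
  (forall r c, P (bx r c)) -> forall b, P b.
Proof.
move=> Pbx [[[|[|i]] lti] c] //.
- have -> : lti = isT by apply: bool_irrelevance.
  exact: (Pbx false c).
- have -> : lti = isT by apply: bool_irrelevance.
  exact: (Pbx true c).
Qed.

Lemma card_box2 : #|{: box [:: n; n]}| = 2 * n.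
Proof.
rewrite card_tagged sumnE big_map big_enum /= !big_ord_recl big_ord0 /=.
by rewrite !card_ord; lia.
Qed.

Lemma SE_neighbor_bx r c r' c' : SE_neighbor (bx r c) (bx r' c') =
  [&& ~~ r, r' & c' == c] || (r == r') && (c' == c.+1 :> nat).
Proof.
by rewrite /SE_neighbor !brow_bx !bcol_bx -val_eqE; case: r; case: r'.
Qed.

(** The default value is the sentinel of [tab]. *)
Definition ent (T : filling [:: n; n]) (r : bool) (c : nat) : nat :=
  if insub c is Some o then T (bx r o) else (max_entry T).+1.

Lemma entE T r (c : 'I_n) : ent T r c = T (bx r c).
Proof. by rewrite /ent valK. Qed.

Lemma ent_end T r c : n <= c -> ent T r c = (max_entry T).+1.
Proof. by move=> le_nc; rewrite /ent insubN // -leqNgt. Qed.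

Lemma ent_le T r c : c < n -> ent T r c <= max_entry T.
Proof.
by move=> lt_cn; rewrite (entE T r (Ordinal lt_cn)) /max_entry leq_bigmax.
Qed.

Lemma filling_ext (T T' : filling [:: n; n]) :
  (forall r c, c < n -> ent T r c = ent T' r c) -> T = T'.
Proof.
move=> E; apply/ffunP; apply: bx_ind => r c.
by rewrite -!entE E.
Qed.

Lemma increasing_tab T : increasing_tableau T ->
  tab n (max_entry T) (ent T false) (ent T true).
Proof.
case/and3P=> /forallP rI /forallP cI /andP[/forallP gt0 /allP onto].
have rowI r : row_incr n.+1 (ent T r).
  move=> i j lt_ij; rewrite ltnS leq_eqVlt => /orP[/eqP Ej|lt_jn].
    by rewrite Ej (ent_end _ _ (leqnn n)) ltnS ent_le // -Ej.
  have lt_in := ltn_trans lt_ij lt_jn.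
  rewrite (entE T r (Ordinal lt_in)) (entE T r (Ordinal lt_jn)).
  have /forallP/(_ (bx r (Ordinal lt_jn)))/implyP := rI (bx r (Ordinal lt_in)).
  by apply; rewrite !brow_bx !bcol_bx eqxx.
split=> //.
- move=> c lt_cn; rewrite !(entE T _ (Ordinal lt_cn)).
  have /forallP/(_ (bx true (Ordinal lt_cn)))/implyP := cI (bx false (Ordinal lt_cn)).
  by apply; rewrite !brow_bx !bcol_bx eqxx.
- by move=> c lt_cn; rewrite !(entE T _ (Ordinal lt_cn)).
- by rewrite ent_end.
- by rewrite ent_end.
move=> v v_in; have : v \in iota 1 (max_entry T) by rewrite mem_iota add1n ltnS.
move/onto/existsP => [b]; move: b; apply: bx_ind => -[] c /eqP tc.
  by right; exists c; rewrite ?entE.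
by left; exists c; rewrite ?entE.
Qed.

Lemma tab_increasing (T : filling [:: n; n]) M t0 t1 : 0 < n -> tab n M t0 t1 ->
  (forall c : 'I_n, T (bx false c) = t0 c) ->
  (forall c : 'I_n, T (bx true c) = t1 c) ->
  increasing_tableau T /\ max_entry T = M.
Proof.
move=> n_gt0 tT T0 T1.
have TE r c : T (bx r c) = (if r then t1 else t0) c by case: r.
have maxT : max_entry T = M.
  apply/eqP; rewrite eqn_leq; apply/andP; split.
    apply/bigmax_leqP => b _; move: b; apply: bx_ind => -[] c; rewrite TE.
      exact: (tab_le1 tT).
    exact: (tab_le0 tT).
  have lt_n1n : n.-1 < n by lia.
  rewrite -(tab_last n_gt0 tT) -(T1 (Ordinal lt_n1n)).
  exact: leq_bigmax.
split=> //; apply/and3P; split.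
- apply/forallP; apply: bx_ind => r c; apply/forallP; apply: bx_ind => r' c'.
  apply/implyP; rewrite !brow_bx !bcol_bx !TE => /andP[/eqP Er lt_cc'].
  case: r r' Er => [] [] // _; first exact: (row_incr1 tT).
  exact: (row_incr0 tT).
- apply/forallP; apply: bx_ind => r c; apply/forallP; apply: bx_ind => r' c'.
  apply/implyP; rewrite !brow_bx !bcol_bx !TE => /andP[/eqP Ec].
  case: r r' => [] [] // _; rewrite -Ec.
  exact: (tab_col tT).
- apply/andP; split.
    apply/forallP; apply: bx_ind => r c; rewrite TE.
    by have := tab_col tT (ltn_ord c); have := tab_gt0 tT (ltn_ord c); case: r; lia.
  apply/allP => v; rewrite mem_iota maxT add1n ltnS => /(tab_onto tT).
  case=> [] [c lt_cn tc]; apply/existsP.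
    by exists (bx false (Ordinal lt_cn)); rewrite TE /= tc.
  by exists (bx true (Ordinal lt_cn)); rewrite TE /= tc.
Qed.

Lemma is_IncP (T : filling [:: n; n]) k : is_Inc k T <->
  tab n (max_entry T) (ent T false) (ent T true) /\ max_entry T + k = 2 * n.
Proof.
rewrite /is_Inc card_box2; split=> [/andP[/increasing_tab tT /eqP] //|[tT ->]].
rewrite eqxx andbT; case: (posnP n) => [n0|n_gt0]; last first.
  by have [] := tab_increasing n_gt0 tT (fun c => esym (entE T _ c))
                 (fun c => esym (entE T _ c)).
have nob (b : box [:: n; n]) : False.
  by move: b; apply: bx_ind => r []; rewrite n0.
have max0 : max_entry T = 0 by rewrite /max_entry big1 // => b; case: (nob b).
apply/and3P; split; try by apply/forallP => b; case: (nob b).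
by rewrite /entries_initial max0 andbT; apply/forallP => b; case: (nob b).
Qed.

(** A missing neighbor behaves like an empty one: neither contributes a label. *)
Definition oget (S : partial_filling [:: n; n]) r c : option nat :=
  if insub c is Some o then S (bx r o) else None.

Lemma ogetE S r (c : 'I_n) : oget S r c = S (bx r c).
Proof. by rewrite /oget valK. Qed.

Lemma oget_end S r c : n <= c -> oget S r c = None.
Proof. by move=> le_nc; rewrite /oget insubN // -leqNgt. Qed.

Definition omin (x y : option nat) : option nat :=
  match x, y with
  | Some u, Some v => Some (minn u v)
  | Some u, None => Some u
  | None, _ => y
  end.

Lemma seq_minP s x : x \in s -> (forall y, y \in s -> x <= y) -> seq_min s = Some x.
Proof.
case: s => //= z s x_in le_x; congr Some; apply/eqP; rewrite eqn_leq; apply/andP.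
have H : forall s', (foldr minn z s' <= z) && all (leq (foldr minn z s')) s'.
  elim=> [|w s' /andP[IH1 IH2]] /=; first by rewrite leqnn.
  rewrite geq_min IH1 orbT geq_minl /=.
  by apply: sub_all IH2 => v; rewrite geq_min => ->; rewrite orbT.
have H' : foldr minn z s \in z :: s.
  elim: {x_in le_x H} s => [|w s' IH] /=; first by rewrite inE.
  case: (leqP w) => _; first by rewrite !inE eqxx orbT.
  by move: IH; rewrite !inE => /orP[] ->; rewrite ?orbT.
split; last exact: le_x.
have /andP[H1 /allP H2] := H s.
by move: x_in; rewrite inE => /orP[/eqP->|/H2].
Qed.

Lemma SE_min_labelP (S : partial_filling [:: n; n]) b x :
  (exists2 b', SE_neighbor b b' & S b' = Some x) ->
  (forall b' y, SE_neighbor b b' -> S b' = Some y -> x <= y) ->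
  SE_min_label S b = Some x.
Proof.
move=> [b' nb Sb'] le_x; apply: seq_minP => [|y]; rewrite mem_pmap.
  by apply/mapP; exists b' => //; rewrite mem_filter nb mem_enum.
case/mapP=> b''; rewrite mem_filter => /andP[nb'' _] /esym; exact: le_x.
Qed.

Lemma SE_min_label_none (S : partial_filling [:: n; n]) b :
  (forall b', SE_neighbor b b' -> S b' = None) -> SE_min_label S b = None.
Proof.
move=> none; rewrite /SE_min_label; case E: (pmap _ _) => [|y s] //.
have : y \in y :: s by rewrite inE eqxx.
rewrite -E mem_pmap => /mapP[b']; rewrite mem_filter => /andP[nb _].
by rewrite none.
Qed.

Lemma SE_min_label0 (S : partial_filling [:: n; n]) (c : 'I_n) :
  SE_min_label S (bx false c) = omin (S (bx true c)) (oget S false c.+1).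
Proof.
have nb1 : SE_neighbor (bx false c) (bx true c).
  by rewrite SE_neighbor_bx /= eqxx.
have nbP b : SE_neighbor (bx false c) b -> b = bx true c \/
    exists2 c', nat_of_ord c' = c.+1 & b = bx false c'.
  move: b; apply: bx_ind => -[] c'; rewrite SE_neighbor_bx /= ?orbF => /eqP E.
    by left; rewrite E.
  by right; exists c'.
case: (ltnP c.+1 n) => [lt_c1n|le_nc1]; last first.
  rewrite oget_end //.
  have nbP' b : SE_neighbor (bx false c) b -> b = bx true c.
    by case/nbP => // -[c' E]; have := ltn_ord c'; lia.
  case E: (S (bx true c)) => [x|] /=.
    apply: SE_min_labelP; first by exists (bx true c).
    by move=> b y /nbP'->; rewrite E => -[->].
  by apply: SE_min_label_none => b /nbP'->.
pose c1 := Ordinal lt_c1n.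
have -> : oget S false c.+1 = S (bx false c1) by rewrite -(ogetE S false c1).
have nb2 : SE_neighbor (bx false c) (bx false c1).
  by rewrite SE_neighbor_bx /= eqxx.
have nbP' b : SE_neighbor (bx false c) b -> b = bx true c \/ b = bx false c1.
  case/nbP => [|[c' E ->]]; first by left.
  by right; congr (bx _ _); apply: val_inj.
case E1: (S (bx true c)) => [x|]; case E2: (S (bx false c1)) => [y|] /=.
- apply: SE_min_labelP.
    case: (leqP x y) => _; first by exists (bx true c).
    by exists (bx false c1).
  by move=> b z /nbP'[]->; rewrite ?E1 ?E2 => -[<-]; rewrite ?geq_minl ?geq_minr.
- apply: SE_min_labelP; first by exists (bx true c).
  by move=> b z /nbP'[]->; rewrite ?E1 ?E2 // => -[<-].
- apply: SE_min_labelP; first by exists (bx false c1).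
  by move=> b z /nbP'[]->; rewrite ?E1 ?E2 // => -[<-].
- by apply: SE_min_label_none => b /nbP'[]->.
Qed.

Lemma SE_min_label1 (S : partial_filling [:: n; n]) (c : 'I_n) :
  SE_min_label S (bx true c) = oget S true c.+1.
Proof.
have nbP b : SE_neighbor (bx true c) b ->
    exists2 c', nat_of_ord c' = c.+1 & b = bx true c'.
  move: b; apply: bx_ind => -[] c'; rewrite SE_neighbor_bx //= => /eqP E.
  by exists c'.
case: (ltnP c.+1 n) => [lt_c1n|le_nc1]; last first.
  rewrite oget_end //; apply: SE_min_label_none => b /nbP[c' E].
  by have := ltn_ord c'; lia.
pose c1 := Ordinal lt_c1n.
have -> : oget S true c.+1 = S (bx true c1) by rewrite -(ogetE S true c1).
have nb2 : SE_neighbor (bx true c) (bx true c1).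
  by rewrite SE_neighbor_bx /= eqxx.
have nbP' b : SE_neighbor (bx true c) b -> b = bx true c1.
  case/nbP => [c' E ->]; by congr (bx _ _); apply: val_inj.
case E2: (S (bx true c1)) => [y|] /=.
- apply: SE_min_labelP; first by exists (bx true c1).
  by move=> b z /nbP'->; rewrite E2 => -[<-].
- by apply: SE_min_label_none => b /nbP'->.
Qed.

End Boxes.

Arguments bx : simpl never.

(** * The sliding process, step by step *)

Section Slide.
Local Open Scope nat_scope.
Variables (n : nat) (T : filling [:: n; n]).
Let M := max_entry T.
Let t0 := ent T false.
Let t1 := ent T true.
Hypotheses (n_gt0 : 0 < n) (tT : tab n M t0 t1).
Let d := touch_col n t0 t1.
Let e := drop_col n t0 t1.

(* The labels after s sliding steps: the empty boxes lie on the antidiagonal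
   of index s, except for the last box, which stays empty. *)
Definition slide_state (s : nat) (r : bool) (c : nat) : option nat :=
  if r then
    if c.+1 < s then (if c.+1 == n then None else Some (slide1 n t0 t1 c))
    else if (c.+1 == s) && (d <= c) then None else Some (t1 c)
  else
    if c < s then Some (slide0 n t0 t1 c)
    else if (c == s) && (s <= e) then None else Some (t0 c).

Arguments slide_state : simpl never.

(** On antidiagonal [s] the upper box, empty if [s <= e], receives the smaller of [t1 s] and
    [t0 s.+1], which is [slide0] at [s]; the lower one, in column [s.-1] and empty if [d < s],
    receives [t1 s] when column [s] exists. *)
Lemma promotion_step_state s (S : partial_filling [:: n; n]) :
  (forall r c, S (bx r c) = slide_state s r c) ->
  forall r c, promotion_step S (bx r c) = slide_state s.+1 r c.
Proof.
move=> SE.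
have [lt_en te be] := drop_colP n_gt0 tT.
have [le_de td bd] := touch_colP n_gt0 tT.
rewrite -/e in lt_en te be le_de; rewrite -/d in le_de td bd.
have OG r (c : nat) : oget S r c = if c < n then slide_state s r c else None.
  case: (ltnP c n) => [lt_cn|le_nc]; last by rewrite oget_end.
  by rewrite (ogetE S r (Ordinal lt_cn)) SE.
have st1 : slide_state s true s = Some (t1 s).
  by rewrite /slide_state !ifF //; lia.
have st0 : slide_state s false s.+1 = Some (t0 s.+1).
  by rewrite /slide_state !ifF //; lia.
have min0 (c : 'I_n) : nat_of_ord c = s -> s <= e ->
    SE_min_label S (bx false c) = Some (slide0 n t0 t1 s).
  move=> Ec le_se; rewrite SE_min_label0 OG SE Ec st1 st0 slide0_eq -/e.
  case: (ltngtP s e) le_se => // [lt_se|->] _.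
    by rewrite (leq_ltn_trans _ lt_en) //= (minn_idPr (be _ lt_se)).
  by case: ifP => //= _; rewrite (minn_idPl (ltnW te)).
have min1 (c : 'I_n) : SE_min_label S (bx true c) =
    if c.+1 < n then slide_state s true c.+1 else None.
  by rewrite SE_min_label1 OG.
have none0 (c : 'I_n) : (S (bx false c) == None) = (c == s :> nat) && (s <= e).
  rewrite SE /slide_state; case: ifP => [lt_cs|_].
    by rewrite ltn_eqF.
  by case: (_ && _).
have none1 (c : 'I_n) : (S (bx true c) == None) =
    (c.+1 < s) && (c.+1 == n) || (c.+1 == s) && (d <= c).
  rewrite SE /slide_state; case: ifP => [lt_cs|_] /=.
    by rewrite (ltn_eqF lt_cs) orbF; case: (c.+1 == n).
  by case: (_ && _).
case=> c; rewrite ffunE SE.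
  have noex x : c < s ->
      [exists b', [&& S b' == None, SE_neighbor b' (bx true c)
         & SE_min_label S b' == Some x]] = false.
    move=> lt_cs; apply/negbTE/existsP => -[b]; move: b.
    apply: bx_ind => -[] c' /and3P[]; rewrite ?none0 ?none1 SE_neighbor_bx /= ?orbF.
      by move=> N /eqP nb; have := ltn_ord c; lia.
    by move=> /andP[/eqP N _] /eqP nb; rewrite nb in lt_cs; lia.
  rewrite {1}/slide_state.
  case: (ltngtP c.+1 s) => [lt_cs|lt_sc|Ec].
  - rewrite /slide_state ltnS (ltnW lt_cs); case: eqP => [E|_].
      by rewrite min1 E ltnn.
    by rewrite noex //; lia.
  (* A box of the second row not yet reached: it is emptied only if [c = s] and [d <= s], its label
     going up when [c = d] and left when [d < c]. *)
  - rewrite /slide_state [in RHS]ltnNge lt_sc /= eqSS.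
    case: ifP => [/existsP[b]|/negbT/existsPn nex].
      move: b; apply: bx_ind => -[] c' /and3P[].
        rewrite none1 SE_neighbor_bx /= => N /eqP nb _.
        by rewrite ifT //; have := ltn_ord c; lia.
      rewrite none0 SE_neighbor_bx /= orbF => /andP[/eqP N le_se] /eqP nb.
      rewrite -nb in N; rewrite -nb min0 // slide0_eq -/e => /eqP[Et].
      rewrite ifT // N eqxx /=; case: (leqP d s) => // lt_sd.
      have := bd _ lt_sd; move: Et; rewrite N.
      by case: (ltngtP s e) le_se => // [_|Es] _; lia.
    case: ifP => // /andP[/eqP Ec le_dc]; move: le_dc; rewrite leq_eqVlt.
    case/orP=> [/eqP Ed|lt_dc].
      have := nex (bx false c); rewrite none0 SE_neighbor_bx min0 //; last by lia.
      rewrite slide0_eq -/e -Ec eqxx -Ed le_de /= eqxx /=.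
      case: (ltngtP d e) le_de => // [lt_de|_] _; last by rewrite eqxx.
      have := be _ lt_de => le1.
      have -> : t0 d.+1 = t1 d by lia.
      by rewrite eqxx.
    have lt_c1n : c.-1 < n by have := ltn_ord c; lia.
    have E1 : c.-1.+1 = c by lia.
    have := nex (bx true (Ordinal lt_c1n)).
    have lt_sn : s < n by rewrite -Ec.
    rewrite none1 SE_neighbor_bx min1 /= E1 Ec eqxx lt_sn st1 eqxx ltnn /=.
    by rewrite andbT -Ec; lia.
  - rewrite /slide_state -Ec ltnSn /=; case: (leqP d c) => [le_dc|lt_cd].
      rewrite min1 slide1_eq -/d (ltnNge c d) le_dc /=.
      by case: (ltngtP c.+1 n) (ltn_ord c) => // lt_c1n _; rewrite Ec st1.
    rewrite noex ?slide1_eq -/d ?lt_cd; last by lia.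
    by rewrite ifF //; lia.
rewrite /slide_state.
case: (ltngtP c s) => [lt_cs|lt_sc|Ec].
- rewrite ltnS (ltnW lt_cs) ifF //; apply/negbTE/existsP => -[b]; move: b.
  apply: bx_ind => -[] c' /and3P[N nb _]; rewrite SE_neighbor_bx //= in nb.
  by move: N nb; rewrite none0; lia.
- rewrite [in RHS]ltnNge lt_sc /=.
  case: ifP => [/existsP[b]|/negbT/existsPn noex].
    move: b; apply: bx_ind => -[] c' /and3P[N]; rewrite SE_neighbor_bx //=.
    move: N; rewrite none0 => /andP[/eqP Ec' le_se] /eqP Ec.
    rewrite min0 // slide0_eq -/e Ec Ec' eqxx /=.
    case: (ltngtP s e) le_se => // -> _ /eqP[Et]; move: te; rewrite Et.
    by rewrite ltnn.
  case: ifP => // /andP[/eqP Ec le_se].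
  have lt_sn : s < n by lia.
  have := noex (bx false (Ordinal lt_sn)).
  rewrite none0 SE_neighbor_bx min0 //= ?eqxx /=; last by lia.
  by rewrite -Ec eqxx slide0_eq -/e le_se /= Ec eqxx; case: leqP le_se => //; lia.
- rewrite [in RHS]ltnS Ec leqnn.
  case: (leqP s e) => [le_se|lt_es] /=; first by rewrite min0.
  rewrite slide0_eq -/e (gtn_eqF lt_es) ltnNge (ltnW lt_es) /= ifF //.
  apply/negbTE/existsP => -[b]; move: b.
  apply: bx_ind => -[] c' /and3P[N nb _]; rewrite SE_neighbor_bx //= in nb.
  by move: N nb; rewrite none0; lia.
Qed.

Lemma delete_one_state r c : delete_one T (bx r c) = slide_state 0 r c.
Proof.
have F := tab_first n_gt0 tT; have lt_cn := ltn_ord c.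
have G := tab_gt0 tT lt_cn; have C := tab_col tT lt_cn.
rewrite ffunE -entE /slide_state; case: r => /=.
  by rewrite ifF //; apply/negbTE; rewrite -/t1; lia.
case: (posnP c) => [->|c_gt0]; first by rewrite -/t0 F.
rewrite ifF //; apply/negbTE; rewrite -/t0.
by have := row_incr0 tT c_gt0 lt_cn; lia.
Qed.

Lemma KpromotionE r (c : 'I_n) : Kpromotion T (bx r c) =
  ((if r then slide1 else slide0) n t0 t1 c).-1.
Proof.
have iterE s r' c' : iter s (@promotion_step _) (delete_one T) (bx r' c') =
    slide_state s r' c'.
  elim: s r' c' => [|s IHs] r' c'; first exact: delete_one_state.
  by rewrite iterS; apply: promotion_step_state.
rewrite ffunE /promotion_slide iterE card_box2 -/M /slide_state.
have lt_cn := ltn_ord c; congr (_.-1); case: r.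
  rewrite ifT; last by lia.
  (* The last box is still empty; its default label [M.+1] is the sentinel read by [slide1]. *)
  case: eqP => //= E; have -> : nat_of_ord c = n.-1 by lia.
  by rewrite (slide1_last n_gt0 tT).
by rewrite ifT //; lia.
Qed.

Lemma ent_Kpromotion :
  [/\ ent (Kpromotion T) false =1 (promote n (t0, t1)).1,
      ent (Kpromotion T) true =1 (promote n (t0, t1)).2
    & max_entry (Kpromotion T) = M].
Proof.
have PE r (c : 'I_n) : Kpromotion T (bx r c) =
    (if r then (promote n (t0, t1)).2 else (promote n (t0, t1)).1) c.
  by rewrite KpromotionE /=; case: r; rewrite ltn_ord.
have tP := tab_promote n_gt0 tT.
have [_ maxP] := tab_increasing n_gt0 tP (PE false) (PE true).
split=> // c; case: (ltnP c n) => [lt_cn|le_nc].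
- by rewrite (entE _ _ (Ordinal lt_cn)) PE.
- by rewrite ent_end // maxP /= ltnNge le_nc /= /t0 ent_end.
- by rewrite (entE _ _ (Ordinal lt_cn)) PE.
- by rewrite ent_end // maxP /= ltnNge le_nc /= /t1 ent_end.
Qed.

End Slide.

(** * Evacuation as a rotation *)

Section Evacuation.
Local Open Scope nat_scope.
Variables (n : nat).

(** The rows of a promoted filling are known only pointwise, so iterating needs this
    compatibility. *)
Lemma promote_ext t t' : t.1 =1 t'.1 -> t.2 =1 t'.2 ->
  (promote n t).1 =1 (promote n t').1 /\ (promote n t).2 =1 (promote n t').2.
Proof.
move=> E1 E2.
have Ee : drop_col n t.1 t.2 = drop_col n t'.1 t'.2.
  by apply: eq_find => c; rewrite E1 E2.
have Ed : touch_col n t.1 t.2 = touch_col n t'.1 t'.2.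
  by apply: eq_find => c; rewrite E1 E2.
by split=> c /=; rewrite /slide0 /slide1 ?Ee ?Ed ?E1 ?E2.
Qed.

Variable T : filling [:: n; n].
Hypotheses (n_gt0 : 0 < n)
  (tT : tab n (max_entry T) (ent T false) (ent T true)).

Lemma ent_iter_Kpromotion i :
  [/\ ent (iter i (@Kpromotion _) T) false =1 (prom n (ent T false) (ent T true) i).1,
      ent (iter i (@Kpromotion _) T) true =1 (prom n (ent T false) (ent T true) i).2,
      max_entry (iter i (@Kpromotion _) T) = max_entry T
    & tab n (max_entry T) (ent (iter i (@Kpromotion _) T) false)
                         (ent (iter i (@Kpromotion _) T) true)].
Proof.
elim: i => [|i [E0 E1 EM tP]] //; rewrite !iterS; set T' := iter i _ T in E0 E1 EM tP *.
rewrite -EM in tP; have [P0 P1 PM] := ent_Kpromotion n_gt0 tP.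
have [Q0 Q1] := @promote_ext (ent T' false, ent T' true)
  (prom n (ent T false) (ent T true) i) E0 E1.
split=> [c|c||]; rewrite ?P0 ?P1 ?Q0 ?Q1 //; first by rewrite PM.
have [r0 r1 cI gt0 e0 e1 onto] := tab_promote n_gt0 tP.
rewrite -EM; split.
- by move=> a b; rewrite !P0; apply: r0.
- by move=> a b; rewrite !P1; apply: r1.
- by move=> c lt_cn; rewrite P0 P1; apply: cI.
- by move=> c lt_cn; rewrite P0; apply: gt0.
- by rewrite P0.
- by rewrite P1.
move=> v /onto[] [c lt_cn tc]; [left|right]; exists c => //.
  by rewrite P0.
by rewrite P1.
Qed.

Definition rotate (S : filling [:: n; n]) : filling [:: n; n] :=
  [ffun b => (max_entry S).+1 - ent S (brow b == 0) (n.-1 - bcol b)].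

Lemma rotate_bx S r (c : 'I_n) :
  rotate S (bx r c) = (max_entry S).+1 - ent S (~~ r) (n.-1 - c).
Proof. by rewrite ffunE brow_bx bcol_bx; case: r. Qed.

Lemma KevacuationE : Kevacuation T = rotate T.
Proof.
set M := max_entry T.
apply/ffunP; apply: bx_ind => r c; rewrite ffunE rotate_bx -/M.
have lt_cn := ltn_ord c.
have le_M r' c' : c' < n -> 0 < ent T r' c' <= M.
  move=> lt_c'n; rewrite ent_le // andbT; have := tab_gt0 tT lt_c'n.
  by have := tab_col tT lt_c'n; case: r' => /=; lia.
(* Column [c] lies within a row of length [n - p] iff [n.-1 - c] is not among the first [p] columns,
   where [p] counts the entries at most [M - j] of the opposite row. *)
have muE j : j <= M -> (bx r c \in boxes_le (iter (M - j) (@Kpromotion _) T) j) =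
    (M - j < ent T (~~ r) (n.-1 - c)).
  move=> le_jM; rewrite inE -entE.
  have [E0 E1 EM tP] := ent_iter_Kpromotion (M - j).
  have [R0 R1] := rank_prom_end n_gt0 tT (leq_subr j M).
  rewrite -/M subKn // in R0 R1.
  have lt_c'n : n.-1 - c < n by lia.
  have tI := tab_prom n_gt0 tT (M - j).
  case: r => /=.
    rewrite E1 -(rankP _ (row_incr1 tI)) // R1.
    by have := @rankP n (ent T false) (M - j) _ (row_incr0 tT) lt_c'n; lia.
  rewrite E0 -(rankP _ (row_incr0 tI)) // R0.
  by have := @rankP n (ent T true) (M - j) _ (row_incr1 tT) lt_c'n; lia.
have /andP[v_gt0 le_vM] := le_M (~~ r) (n.-1 - c) ltac:(lia).
set v := ent T _ _ in muE v_gt0 le_vM *.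
(* The box enters the chain when [M - j < v] first holds, that is at [j = M.+1 - v]. *)
have lt_j0 : M.+1 - v < M.+1 by lia.
case: pickP => [j /=|/(_ (Ordinal lt_j0))] /=.
  case/andP=> j_gt0; rewrite inE !muE; have := ltn_ord j; lia.
by rewrite inE !muE; lia.
Qed.

End Evacuation.

(** * The bijection between tableaux and words *)

Section Words.
Local Open Scope nat_scope.

(* A letter tells in which of the two rows a value occurs.  Words list the
   letters of an increasing tableau from the largest value down, so that the
   tail of a word is the word of the tableau restricted to smaller values. *)
Notation letter := (bool * bool)%type.

Definition swap (x : letter) : letter := (x.2, x.1).

Definition step (x : letter) (h : nat) : option nat :=
  match x, h with
  | (true, false), _ => Some h.+1
  | (false, true), h'.+1 => Some h'
  | (true, true), _.+1 => Some h
  | _, _ => None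
  end.

Definition run (w : seq letter) (h : nat) : option nat :=
  foldr (fun x o => obind (step x) o) (Some h) w.

Definition doubles (w : seq letter) := count_mem (true, true) w.

Fixpoint words (l : nat) : seq (seq letter) :=
  if l is l'.+1 then
    map (cons (true, false)) (words l') ++ map (cons (false, true)) (words l')
      ++ map (cons (true, true)) (words l')
  else [:: [::]].

Lemma mem_map_cons (x y : letter) w (s : seq (seq letter)) :
  (x :: w \in map (cons y) s) = (x == y) && (w \in s).
Proof.
apply/mapP/andP => [[v v_in [-> ->]]|[/eqP-> w_in]]; first by rewrite eqxx.
by exists w.
Qed.

Lemma mem_words l w :
  (w \in words l) = (size w == l) && all (fun x => x.1 || x.2) w.
Proof.
elim: l w => [|l IHl] [|x w] //=.
  by rewrite !mem_cat; apply/negbTE; rewrite !negb_or; apply/and3P; split;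
     apply/mapP => -[].
rewrite !mem_cat !mem_map_cons IHl eqSS.
by case: x => [[] []]; rewrite /= ?orbF ?andbF.
Qed.

Lemma uniq_words l : uniq (words l).
Proof.
elim: l => // l IHl /=.
have inj x : injective (@cons letter x) by move=> ? ? [].
rewrite !cat_uniq !map_inj_uniq // IHl /= andbT has_cat negb_or.
have dis x y : x != y ->
    ~~ has (mem (map (cons x) (words l))) (map (cons y) (words l)).
  move=> ne; apply/hasPn => w /mapP[v _ ->] /=.
  by rewrite mem_map_cons eq_sym (negbTE ne).
by rewrite !dis.
Qed.

Lemma run_cat w1 w2 h : run (w1 ++ w2) h = obind (run w1) (run w2 h).
Proof.
rewrite /run foldr_cat; case: (foldr _ _ w2) => [h'|] //=.
by elim: w1 => //= x w ->.
Qed.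

Lemma step_swap x h h' : step x h = Some h' -> step (swap x) h' = Some h.
Proof. by case: x => [[] []]; case: h => [|h] //= [<-]. Qed.

Lemma swapK : involutive swap.
Proof. by case. Qed.

Lemma run_rev w h h' : run w h = Some h' -> run (map swap (rev w)) h' = Some h.
Proof.
elim: w h' => [|x w IHw] h' /=; first by case=> ->.
case E: (run w h) => [h''|] //= /step_swap sx.
by rewrite rev_cons map_rcons -cats1 run_cat (_ : run [:: swap x] h' = Some h'') //= IHw.
Qed.

Lemma doubles_rev w : doubles (map swap (rev w)) = doubles w.
Proof.
rewrite /doubles count_map -count_rev revK; apply: eq_count => -[x y] /=.
by rewrite !xpair_eqE andbC.
Qed.

Lemma run_all w h h' : run w h = Some h' -> all (fun x => x.1 || x.2) w.
Proof.
elim: w h' => //= x w IHw h'; case E: (run w h) => [h''|] //=.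
by case: x => [[] []] //=; rewrite (IHw _ E).
Qed.

Lemma run_count w h h' : run w h = Some h' ->
  h + count fst w = h' + count snd w /\
  count fst w + count snd w = size w + doubles w.
Proof.
elim: w h' => [|x w IHw] h' /=; first by case=> ->.
case E: (run w h) => [h''|] //=; have [] := IHw _ E.
rewrite /doubles /=; case: x => [[] []] //=; case: h'' {E} => [|h''] //= ? ? [<-];
  rewrite ?eqxx /=; lia.
Qed.

Lemma count_bij (A B : eqType) (s1 : seq A) (s2 : seq B) (P1 : pred A) (P2 : pred B)
    (f : A -> B) (g : B -> A) : uniq s1 -> uniq s2 ->
  (forall x, x \in s1 -> P1 x -> [/\ f x \in s2, P2 (f x) & g (f x) = x]) ->
  (forall y, y \in s2 -> P2 y -> [/\ g y \in s1, P1 (g y) & f (g y) = y]) ->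
  count P1 s1 = count P2 s2.
Proof.
have half (A' B' : eqType) (r1 : seq A') (r2 : seq B') (Q1 : pred A') (Q2 : pred B')
    (f' : A' -> B') (g' : B' -> A') : uniq r1 ->
    (forall x, x \in r1 -> Q1 x -> [/\ f' x \in r2, Q2 (f' x) & g' (f' x) = x]) ->
    count Q1 r1 <= count Q2 r2.
  move=> u1 fP; rewrite -!size_filter -(size_map f'); apply: uniq_leq_size.
    rewrite map_inj_in_uniq ?filter_uniq // => x y.
    rewrite !mem_filter => /andP[Qx x_in] /andP[Qy y_in] E.
    by have [_ _ <-] := fP x x_in Qx; rewrite E; have [] := fP y y_in Qy.
  move=> y /mapP[x]; rewrite !mem_filter => /andP[Qx x_in] ->.
  by have [-> -> _] := fP x x_in Qx.
move=> u1 u2 fP gP; apply/eqP; rewrite eqn_leq.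
by rewrite (half _ _ _ _ _ _ _ _ u1 fP) (half _ _ _ _ _ _ _ _ u2 gP).
Qed.

Fixpoint word_of (P0 P1 : pred nat) (l : nat) : seq letter :=
  if l is l'.+1 then (P0 l, P1 l) :: word_of P0 P1 l' else [::].

Lemma size_word_of P0 P1 l : size (word_of P0 P1 l) = l.
Proof. by elim: l => //= l ->. Qed.

Lemma nth_word_of P0 P1 l i : i < l ->
  nth (false, false) (word_of P0 P1 l) i = (P0 (l - i), P1 (l - i)).
Proof. by elim: l i => // l IHl [|i] //= /IHl. Qed.

Lemma word_of_rev P0 P1 l : map swap (rev (word_of P0 P1 l)) =
  word_of (fun v => P1 (l.+1 - v)) (fun v => P0 (l.+1 - v)) l.
Proof.
apply: (@eq_from_nth _ (false, false)).
  by rewrite size_map size_rev !size_word_of.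
move=> i; rewrite size_map size_rev size_word_of => lt_il.
rewrite nth_word_of // (nth_map (false, false)) ?size_rev ?size_word_of //.
rewrite nth_rev ?size_word_of // nth_word_of; last by lia.
by rewrite /swap /=; congr (P1 _, P0 _); lia.
Qed.

Lemma eq_word_of P0 P1 Q0 Q1 l :
  (forall v, 0 < v <= l -> P0 v = Q0 v /\ P1 v = Q1 v) ->
  word_of P0 P1 l = word_of Q0 Q1 l.
Proof.
elim: l => // l IHl E /=; rewrite IHl; last by move=> v v_in; apply: E; lia.
by have [|-> ->] := E l.+1; rewrite ?leqnn.
Qed.

(** The head of [w] stands for the value [size w], so it is appended at the end and the list is
    increasing: it is the row selected by [f]. *)
Fixpoint positions (f : pred letter) (w : seq letter) : seq nat :=
  if w is x :: w' then
    if f x then rcons (positions f w') (size w) else positions f w'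
  else [::].

Lemma size_positions f w : size (positions f w) = count f w.
Proof. by elim: w => //= x w IHw; case: ifP; rewrite ?size_rcons IHw. Qed.

Lemma positions_bound f w v : v \in positions f w -> 0 < v <= size w.
Proof.
elim: w => //= x w IHw; case: ifP => _; last by move/IHw; lia.
by rewrite mem_rcons inE => /orP[/eqP->|/IHw]; lia.
Qed.

Lemma positions_incr f w v0 i j : i < j -> j < size (positions f w) ->
  nth v0 (positions f w) i < nth v0 (positions f w) j.
Proof.
elim: w => //= x w IHw; case: ifP => _ // lt_ij.
rewrite size_rcons ltnS leq_eqVlt => /orP[/eqP Ej|lt_j].
  rewrite !nth_rcons Ej ltnn eqxx -Ej lt_ij ltnS.
  have : nth v0 (positions f w) i \in positions f w by rewrite mem_nth // -Ej.
  by move/positions_bound => /andP[].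
by rewrite !nth_rcons lt_j (ltn_trans lt_ij lt_j) IHw.
Qed.

(** A letter of the second row is read at positive height, so the first row already has more entries
    among the smaller values and its entry in that column exists. *)
Lemma positions_col w v0 h' : run w 0 = Some h' -> forall c, c < count snd w ->
  nth v0 (positions fst w) c < nth v0 (positions snd w) c.
Proof.
elim: w h' => //= x w IHw h'; case E: (run w 0) => [h|] //=.
have IH := IHw _ E; have [C1 C2] := run_count E.
have B c : c < count fst w -> nth v0 (positions fst w) c < (size w).+1.
  rewrite -size_positions => lt_c; rewrite ltnS.
  by have /andP[] := positions_bound (mem_nth v0 lt_c).
case: x => [[] []] //=.
- case: h C1 {E IHw} => // h C1 _ c; rewrite add1n ltnS leq_eqVlt.
  case/orP=> [/eqP Ec|lt_c]; rewrite !nth_rcons !size_positions.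
    rewrite Ec ltnn eqxx ifT ?B //; lia.
  by rewrite lt_c ifT ?IH //; lia.
- by move=> _ c lt_c; rewrite nth_rcons size_positions ifT ?IH //; lia.
- case: h C1 {E IHw} => // h C1 _ c; rewrite add1n ltnS leq_eqVlt.
  case/orP=> [/eqP Ec|lt_c]; rewrite !nth_rcons !size_positions.
    by rewrite Ec ltnn eqxx B //; lia.
  by rewrite lt_c IH.
Qed.

Lemma positions_onto w v : all (fun x => x.1 || x.2) w -> 0 < v <= size w ->
  (v \in positions fst w) || (v \in positions snd w).
Proof.
elim: w => [|x w IHw] /=; first by lia.
case/andP=> x_in /IHw IH v_in.
case: (ltnP (size w) v) => [lt_wv|le_vw]; last first.
  have {}IH := IH ltac:(lia).
  by case: ifP => _; case: ifP => _; rewrite ?mem_rcons ?inE;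
     case/orP: IH => ->; rewrite ?orbT.
have -> : v = (size w).+1 by lia.
by case/orP: x_in => ->; rewrite mem_rcons inE eqxx ?orbT.
Qed.

Lemma word_of_positions w :
  word_of (mem (positions fst w)) (mem (positions snd w)) (size w) = w.
Proof.
elim: w => //= x w IHw.
have S f : ((size w).+1 \in
    (if f x then rcons (positions f w) (size w).+1 else positions f w)) = f x.
  case: ifP => _; first by rewrite mem_rcons inE eqxx.
  by apply/negbTE/negP => /positions_bound; lia.
rewrite !S -surjective_pairing; congr (_ :: _); rewrite -[RHS]IHw.
apply: eq_word_of => v v_in /=.
by split; case: ifP => _ //; rewrite mem_rcons inE ltn_eqF //; lia.
Qed.

Section TableauWord.
Variable n : nat.

Definition occurs (t : nat -> nat) (v : nat) := has (fun c => t c == v) (iota 0 n).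

Definition word (T : filling [:: n; n]) : seq letter :=
  word_of (occurs (ent T false)) (occurs (ent T true)) (max_entry T).

Definition tableau_of (w : seq letter) : filling [:: n; n] :=
  [ffun b => nth 0 (positions (if brow b == 0 then fst else snd) w) (bcol b)].

Lemma tableau_of_bx w r (c : 'I_n) :
  tableau_of w (bx r c) = nth 0 (positions (if r then snd else fst) w) c.
Proof. by rewrite ffunE brow_bx bcol_bx; case: r. Qed.

Lemma positions_word_of t P0 P1 (f : bool) l : row_incr n t ->
  (forall c, c < n -> 0 < t c) -> (if f then P1 else P0) =1 occurs t ->
  positions (if f then snd else fst) (word_of P0 P1 l) =
    map t (iota 0 (rank n t l)).
Proof.
move=> tI t_gt0 PE; elim: l => [|l IHl] /=.
  by rewrite rank0.
rewrite size_word_of IHl (rankS _ tI) -/(occurs t l.+1) -PE.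
have -> : (if f then snd else fst) (P0 l.+1, P1 l.+1) = (if f then P1 else P0) l.+1.
  by case: f {IHl PE}.
case: ifP => [|_]; last by rewrite addn0.
rewrite PE => /hasP[c]; rewrite mem_iota add0n => /= lt_cn /eqP tc.
rewrite iotaD map_cat /= cats1 add0n; congr rcons.
suff -> : rank n t l = c by [].
apply: rank_eq => [|c' lt_c'n]; first exact: ltnW.
by case: (ltngtP c' c) => [/tI|/tI|->]; lia.
Qed.

Variable k : nat.
Hypotheses (n_gt0 : 0 < n) (le_kn : k <= n).

Definition Inc_word (w : seq letter) := (run w 0 == Some 0) && (doubles w == k).

Lemma run_word (T : filling [:: n; n]) M : tab n M (ent T false) (ent T true) -> forall l, l <= M ->
  run (word_of (occurs (ent T false)) (occurs (ent T true)) l) 0 =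
    Some (rank n (ent T false) l - rank n (ent T true) l).
Proof.
move=> tT; elim=> [|l IHl] lt_lM /=.
  by have [-> ->] := tab_rank0 n_gt0 tT.
rewrite -/(run _ 0) IHl /=; last exact: ltnW.
have [x [y [E1 E2 xy]]] := tab_rankS n_gt0 tT lt_lM.
have L1 := tab_rank_le n_gt0 tT l; have L2 := tab_rank_leS n_gt0 tT l.
move: L2 E1 E2; rewrite (rankS _ (row_incr0 tT)) (rankS _ (row_incr1 tT)).
rewrite -/(occurs _ _) -/(occurs _ _).
move: (rank n _ l) (rank n _ l) L1 => a b L1.
have [h ->] : exists h, a = b + h by exists (a - b); rewrite subnKC.
case: (occurs _ _); case: (occurs _ _); move: x y xy => [] [] //= _ L2 E1 E2; try lia.
all: case: h E1 L2 => [|h] E1 L2; try lia.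
all: by rewrite addKn /=; congr Some; lia.
Qed.

Lemma doubles_word (T : filling [:: n; n]) M : tab n M (ent T false) (ent T true) -> M + k = 2 * n ->
  doubles (word_of (occurs (ent T false)) (occurs (ent T true)) M) = k.
Proof.
move=> tT EM; have RM := run_word tT (leqnn M).
have [_] := run_count RM; rewrite size_word_of.
have gt1 c : c < n -> 0 < ent T true c.
  by move=> lt_cn; have := tab_col tT lt_cn; lia.
have P0 := @positions_word_of (ent T false) _ (occurs (ent T true)) false M
  (row_incr0 tT) (tab_gt0 tT) (frefl _).
have P1 := @positions_word_of (ent T true) (occurs (ent T false)) _ true M
  (row_incr1 tT) gt1 (frefl _).
rewrite -!size_positions P0 P1 !size_map !size_iota.
by have [-> ->] := tab_rank_end n_gt0 tT (leqnn M); lia.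
Qed.

Lemma wordP (T : filling [:: n; n]) : is_Inc k T ->
  [/\ word T \in words (2 * n - k), Inc_word (word T) & tableau_of (word T) = T].
Proof.
case/is_IncP => tT EM; have RM := run_word tT (leqnn _).
have [E0 E1] := tab_rank_end n_gt0 tT (leqnn _).
rewrite E0 E1 subnn in RM.
have gt1 c : c < n -> 0 < ent T true c.
  by move=> lt_cn; have := tab_col tT lt_cn; lia.
split.
- by rewrite mem_words (run_all RM) size_word_of -EM addnK eqxx.
- by rewrite /Inc_word RM (doubles_word tT EM) !eqxx.
apply/ffunP; apply: bx_ind => r c; rewrite tableau_of_bx -entE; case: r.
  rewrite (@positions_word_of (ent T true) (occurs (ent T false)) _ true _
    (row_incr1 tT) gt1 (frefl _)) E1.
  by rewrite (nth_map 0) ?size_iota // nth_iota.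
rewrite (@positions_word_of (ent T false) _ (occurs (ent T true)) false _
  (row_incr0 tT) (tab_gt0 tT) (frefl _)) E0.
by rewrite (nth_map 0) ?size_iota // nth_iota.
Qed.

Lemma tableau_ofP (w : seq letter) : w \in words (2 * n - k) -> Inc_word w ->
  is_Inc k (tableau_of w) /\ word (tableau_of w) = w.
Proof.
rewrite mem_words => /andP[/eqP sz all_w] /andP[/eqP rw /eqP dw].
have [C1 C2] := run_count rw; rewrite sz dw in C2.
have [c0 c1] : count fst w = n /\ count snd w = n by lia.
set M := 2 * n - k in sz.
(* The default value of [nth] supplies the sentinel in column [n]. *)
pose t f c := nth M.+1 (positions f w) c.
have tI f : count f w = n -> row_incr n.+1 (t f).
  move=> cf i j lt_ij; rewrite ltnS leq_eqVlt => /orP[/eqP Ej|lt_jn].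
    have lt_i : i < size (positions f w) by rewrite size_positions cf -Ej.
    rewrite /t [nth _ _ j]nth_default ?size_positions ?cf ?Ej // ltnS.
    by have /andP[_] := positions_bound (mem_nth M.+1 lt_i); rewrite sz.
  by apply: positions_incr => //; rewrite size_positions cf.
have tT : tab n M (t fst) (t snd).
  split; [exact: tI | exact: tI | | | | |].
  - by move=> c lt_cn; apply: (positions_col _ rw); rewrite c1.
  - move=> c lt_cn; have lt_c : c < size (positions fst w).
      by rewrite size_positions c0.
    by have /andP[] := positions_bound (mem_nth M.+1 lt_c).
  - by rewrite /t nth_default // size_positions c0.
  - by rewrite /t nth_default // size_positions c1.
  move=> v; rewrite -sz => v_in.
  by case/orP: (positions_onto all_w v_in) => /(nthP M.+1)[c];
     rewrite size_positions ?c0 ?c1 => lt_cn tc; [left|right]; exists c.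
have TE r (c : 'I_n) : tableau_of w (bx r c) = (if r then t snd else t fst) c.
  rewrite tableau_of_bx; case: r; apply: set_nth_default.
    by rewrite size_positions c1.
  by rewrite size_positions c0.
have [inc maxT] := tab_increasing n_gt0 tT (TE false) (TE true).
split; first by rewrite /is_Inc inc maxT card_box2 /=; apply/eqP; lia.
rewrite /word maxT -sz -[RHS]word_of_positions; apply: eq_word_of => v _.
have occE r : occurs (ent (tableau_of w) r) v =
    (v \in positions (if r then snd else fst) w).
  apply/hasP/(nthP M.+1) => [[c]|[c]].
    rewrite mem_iota add0n => /= lt_cn.
    rewrite (entE _ _ (Ordinal lt_cn)) TE => /eqP tc.
    by exists c; [rewrite size_positions; case: r {tc}; rewrite ?c0 ?c1 | case: r tc].
  rewrite size_positions => lt_c tc.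
  have lt_cn : c < n by case: r lt_c {tc}; rewrite ?c0 ?c1.
  exists c; first by rewrite mem_iota.
  by rewrite (entE _ _ (Ordinal lt_cn)) TE; apply/eqP; case: r tc {lt_c}.
by rewrite !occE.
Qed.

(** The truncated [n.-1 - c] would send column [n] to column 0, so the sentinel is set
    separately. *)
Lemma tab_rotate M t0 t1 : tab n M t0 t1 ->
  tab n M (fun c => if c < n then M.+1 - t1 (n.-1 - c) else M.+1)
          (fun c => if c < n then M.+1 - t0 (n.-1 - c) else M.+1).
Proof.
move=> tT; have I0 := row_incr0 tT; have I1 := row_incr1 tT.
have P0 := tab_gt0 tT; have C := tab_col tT; have L1 c := @tab_le1 _ _ _ _ tT c.
split.
- move=> i j lt_ij; rewrite ltnS => le_jn; rewrite ifT; last by lia.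
  have [] : n.-1 - i < n /\ n.-1 - j < n by lia.
  move=> /[dup] /C + /[dup] /C; case: ifP => lt_jn ? ?.
    by have := I1 (n.-1 - j) (n.-1 - i); have := L1 (n.-1 - i); lia.
  by have := L1 (n.-1 - i); lia.
- move=> i j lt_ij; rewrite ltnS => le_jn; rewrite ifT; last by lia.
  have lt_i : n.-1 - i < n by lia.
  have := P0 _ lt_i; have := C _ lt_i; have := L1 _ lt_i; case: ifP => lt_jn.
    by have := I0 (n.-1 - j) (n.-1 - i); lia.
  by lia.
- move=> c lt_cn; rewrite lt_cn; have lt_i : n.-1 - c < n by lia.
  by have := C _ lt_i; have := L1 _ lt_i; lia.
- move=> c lt_cn; rewrite lt_cn; have lt_i : n.-1 - c < n by lia.
  by have := L1 _ lt_i; lia.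
- by rewrite ltnn.
- by rewrite ltnn.
move=> v v_in; have [|[c lt_cn tc]|[c lt_cn tc]] := @tab_onto _ _ _ _ tT (M.+1 - v).
- by lia.
- right; exists (n.-1 - c); first by lia.
  rewrite ifT; last by lia.
  by have -> : n.-1 - (n.-1 - c) = c by [lia]; rewrite tc; lia.
- left; exists (n.-1 - c); first by lia.
  rewrite ifT; last by lia.
  by have -> : n.-1 - (n.-1 - c) = c by [lia]; rewrite tc; lia.
Qed.

Lemma rotateP (T : filling [:: n; n]) : is_Inc k T ->
  [/\ is_Inc k (rotate T), rotate (rotate T) = T
    & word (rotate T) = map swap (rev (word T))].
Proof.
case/is_IncP => tT EM; have tR := tab_rotate tT.
have RE r (c : 'I_n) : rotate T (bx r c) = (max_entry T).+1 - ent T (~~ r) (n.-1 - c).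
  by rewrite rotate_bx.
have [||inc maxR] := @tab_increasing n (rotate T) _ _ _ n_gt0 tR.
- by move=> c; rewrite RE ltn_ord.
- by move=> c; rewrite RE ltn_ord.
have entR r c : c < n ->
    ent (rotate T) r c = (max_entry T).+1 - ent T (~~ r) (n.-1 - c).
  by move=> lt_cn; rewrite (entE _ _ (Ordinal lt_cn)) RE.
have le_ent r c : c < n -> ent T r c <= max_entry T by apply: ent_le.
split.
- by rewrite /is_Inc inc maxR EM card_box2 eqxx.
- apply: filling_ext => r c lt_cn; rewrite (entE _ _ (Ordinal lt_cn)) rotate_bx /=.
  rewrite maxR entR ?negbK; last by lia.
  have -> : n.-1 - (n.-1 - c) = c by lia.
  by have := le_ent r c lt_cn; lia.
rewrite /word word_of_rev maxR; apply: eq_word_of => v v_in.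
have occR r : occurs (ent (rotate T) r) v =
    occurs (ent T (~~ r)) ((max_entry T).+1 - v).
  apply/hasP/hasP => -[c]; rewrite mem_iota add0n => /= lt_cn.
    rewrite entR // => /eqP tc; exists (n.-1 - c); first by rewrite mem_iota; lia.
    by have := le_ent (~~ r) (n.-1 - c); lia.
  move=> /eqP tc; exists (n.-1 - c); first by rewrite mem_iota; lia.
  rewrite entR; last by lia.
  have -> : n.-1 - (n.-1 - c) = c by lia.
  by rewrite tc; lia.
by rewrite !occR.
Qed.

End TableauWord.

End Words.

(** For the side conditions of [field]: the denominators are made of factorials and affine forms
    that are positive for nonnegative variables, hence the ordered field below. *)
Ltac nonzero := repeat (apply/andP; split); apply: lt0r_neq0;
  first [by rewrite ltr0n fact_gt0 | lra].

(** * Closed forms for the numbers of paths and of prefixes *)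

Section PathCounts.
Local Open Scope nat_scope.

Definition npaths l h k : nat :=
  count (fun w => (run w 0 == Some h) && (doubles w == k)) (words l).

Definition nprefixes l k : nat :=
  count (fun w => (run w 0 != None) && (doubles w == k)) (words l).

Lemma count_words (P : pred (seq (bool * bool))) l : count P (words l.+1) =
  count (fun w => P ((true, false) :: w)) (words l) +
  (count (fun w => P ((false, true) :: w)) (words l) +
   count (fun w => P ((true, true) :: w)) (words l)).
Proof. by rewrite /= !count_cat !count_map. Qed.

Lemma npaths0 h k : npaths 0 h k = (h == 0) && (k == 0).
Proof. by rewrite /npaths /= addn0; case: h; case: k. Qed.

Lemma npathsS l h k : npaths l.+1 h k =
  (if h is h'.+1 then npaths l h' k else 0) + (npaths l h.+1 k +
   (if (h, k) is (_.+1, k'.+1) then npaths l h k' else 0)).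
Proof.
rewrite /npaths count_words; congr (_ + (_ + _)).
- case: h => [|h].
    rewrite -[RHS](count_pred0 (words l)); apply: eq_count => w /=.
    by case: (run w 0).
  by apply: eq_count => w /=; case: (run w 0).
- apply: eq_count => w /=; case: (run w 0) => [[|h']|] //=.
- case: h => [|h].
    rewrite -[RHS](count_pred0 (words l)); apply: eq_count => w /=.
    by case: (run w 0) => [[|h']|].
  case: k => [|k].
    rewrite -[RHS](count_pred0 (words l)); apply: eq_count => w /=.
    by rewrite andbF.
  apply: eq_count => w; rewrite /doubles /= add1n eqSS.
  by case: (run w 0) => [[|h']|].
Qed.

Lemma nprefixes0 k : nprefixes 0 k = (k == 0).
Proof. by rewrite /nprefixes /= addn0; case: k. Qed.

Lemma count_add (A : Type) (P Q R : pred A) s :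
  (forall x, (P x : nat) = Q x + R x) -> count P s = count Q s + count R s.
Proof. by move=> E; elim: s => //= x s ->; rewrite E; lia. Qed.

(** Down and double steps can only follow a prefix of positive height, so the recurrence for
    [nprefixes] involves this number. *)
Definition npositive l k : nat :=
  count (fun w => (if run w 0 is Some h.+1 then true else false) && (doubles w == k))
    (words l).

Lemma npositiveE l k : nprefixes l k = npositive l k + npaths l 0 k.
Proof.
apply: count_add => w; case: (run w 0) => [[|h]|] //=.
by rewrite addn0.
Qed.

Lemma nprefixesS l k : nprefixes l.+1 k =
  nprefixes l k + npositive l k + (if k is k'.+1 then npositive l k' else 0).
Proof.
rewrite /nprefixes count_words addnA; congr (_ + _ + _).
- by apply: eq_count => w /=; case: (run w 0).
- by apply: eq_count => w /=; case: (run w 0) => [[|h]|].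
case: k => [|k].
  rewrite -[RHS](count_pred0 (words l)); apply: eq_count => w /=.
  by rewrite andbF.
by apply: eq_count => w; rewrite /doubles /= add1n eqSS; case: (run w 0) => [[|h]|].
Qed.

Lemma npaths_small l h k : l < h + k -> npaths l h k = 0.
Proof.
elim: l h k => [|l IHl] h k lt_l; first by rewrite npaths0; case: h k lt_l => [|h] [].
rewrite npathsS IHl; last by lia.
case: h lt_l => [|h] lt_l //; rewrite IHl; last by lia.
by case: k lt_l => // k lt_l; rewrite IHl //; lia.
Qed.

(** With [u] up and [d] down steps, [l = u + d + k] and [h = u - d], so [l + h + k] is even. *)
Lemma npaths_odd l h k : odd (l + h + k) -> npaths l h k = 0.
Proof.
elim: l h k => [|l IHl] h k odd_l; first by rewrite npaths0; case: h k odd_l => [|h] [].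
rewrite npathsS IHl; last by lia.
case: h odd_l => [|h] odd_l //; rewrite IHl; last by lia.
by case: k odd_l => // k odd_l; rewrite IHl //; lia.
Qed.

Lemma nprefixes_small l k : l < k -> nprefixes l k = 0.
Proof.
elim: l k => [|l IHl] k lt_l; first by rewrite nprefixes0; case: k lt_l.
rewrite nprefixesS IHl; last by lia.
have P0 k' : l < k' -> npositive l k' = 0.
  by move=> lt; have := npositiveE l k'; rewrite IHl //; lia.
by rewrite P0; [case: k lt_l => // k lt_l; rewrite P0 | lia].
Qed.

Lemma npaths_flat k : npaths k 0 k = (k == 0).
Proof.
case: k => [|k]; first by rewrite npaths0.
by rewrite npathsS npaths_small //; lia.
Qed.

Lemma nprefixes_flat k : nprefixes k k = (k == 0) /\ npositive k k = 0.
Proof.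
elim: k => [|k [IH1 IH2]]; first by rewrite nprefixes0.
have N : nprefixes k.+1 k.+1 = 0.
  have := npositiveE k k.+1.
  by rewrite nprefixesS nprefixes_small // IH2; lia.
by split=> //; have := npositiveE k.+1 k.+1; lia.
Qed.

Local Open Scope ring_scope.
Section ClosedForms.
Variable R : realFieldType.

Local Notation F m := (m%N`!%:R : R).

Lemma F_S m : F m.+1 = (m%:R + 1) * F m.
Proof. by rewrite factS natrM -natr1. Qed.

(* Value of [npaths] for u up steps, d down steps and k double letters, found by
   solving the recurrence [npathsS] extended to d = u + 1 with the boundary
   condition G (u - 1) u k + G u u (k - 1) = 0, where G is [path_formula]. *)
Definition path_formula (u d k : nat) : R :=
  F (u + d + k) / (F u * F d * F k) *
  (u%:R * (u%:R + k%:R + 1) - d%:R * (u%:R + k%:R)) /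
  ((u%:R + k%:R) * (u%:R + k%:R + 1)).

Lemma path_formula_rec u d k : path_formula u.+2 d k =
  path_formula u.+1 d k + (if d is d'.+1 then path_formula u.+2 d' k else 0) +
               (if k is k'.+1 then path_formula u.+2 d k' else 0).
Proof.
have u0 : 0 <= u%:R :> R by rewrite ler0n.
have nat0 m : 0 <= m%:R :> R by rewrite ler0n.
case: d => [|d]; case: k => [|k];
  rewrite /path_formula ?addnS ?addSn ?addn0 ?F_S -!natr1 ?natrD ?addr0 ?add0r;
  try pose proof (nat0 d); try pose proof (nat0 k); by field; nonzero.
Qed.

Lemma path_formula_diag u k : path_formula u.+1 u.+1 k = path_formula u.+1 u k.
Proof.
have u0 : 0 <= u%:R :> R by rewrite ler0n.
have k0 : 0 <= k%:R :> R by rewrite ler0n.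
by rewrite /path_formula ?addnS ?addSn ?F_S -!natr1 ?natrD; field; nonzero.
Qed.

Lemma path_formula_first k : path_formula 1 0 k = 1.
Proof.
have k0 : 0 <= k%:R :> R by rewrite ler0n.
rewrite /path_formula addn0 add1n F_S !fact0 factS fact0.
by field; nonzero.
Qed.

(** At least one up step is assumed because [path_formula 0 0 0] has denominator 0. *)
Lemma npathsE l u d k : l = (u.+1 + d + k)%N -> (d <= u.+1)%N ->
  (npaths l (u.+1 - d)%N k)%:R = path_formula u.+1 d k.
Proof.
elim: l u d k => // l IHl u d k El; rewrite leq_eqVlt => /orP[/eqP Ed|].
  rewrite Ed subnn npathsS add0n addn0 path_formula_diag -IHl; [|lia|lia].
  by rewrite subSn // subnn.
rewrite ltnS => le_du; rewrite subSn // npathsS !natrD addrA.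
have -> : (npaths l (u - d)%N.+2 k)%:R = if d is d'.+1 then path_formula u.+1 d' k else 0.
  case: d El le_du => [|d] El le_du; first by rewrite npaths_small //; lia.
  by rewrite -IHl; [congr ((npaths _ _ _)%:R); lia | lia | lia].
have -> : (if k is k'.+1 then npaths l (u - d).+1 k' else 0)%N%:R =
    if k is k'.+1 then path_formula u.+1 d k' else 0.
  case: k El => [|k] El //.
  by rewrite -IHl; [congr ((npaths _ _ _)%:R); lia | lia | lia].
(* With a single up step and no down step the up step comes first, so there is one path for each
   [k]. *)
case: u El le_du => [|u] El le_du; last first.
  by rewrite path_formula_rec -IHl //; lia.
have Ed : d = 0%N by lia.
subst d; have -> : l = k by lia.
rewrite subnn npaths_flat path_formula_first; case: k {El} => [|k] /=.
  by rewrite addr0 addr0.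
by rewrite path_formula_first !add0r.
Qed.

(* Numbers of prefixes with an odd, respectively positive even, number of steps
   that change the height. *)
Definition prefix_odd b j : R :=
  F (b + b + j).+1 / (F j * F b * F b * (j%:R + b%:R + 1)).
Definition prefix_even b j : R :=
  F (b + b + j).+2 / (F j * F b.+1 * F b * (j%:R + b%:R + 1)).

Lemma prefix_odd_rec b j : prefix_odd b.+1 j =
  prefix_even b j + (prefix_even b j - path_formula b.+1 b.+1 j) + (if j is j'.+1 then prefix_odd b.+1 j' else 0).
Proof.
have u0 : 0 <= b%:R :> R by rewrite ler0n.
have k0 : 0 <= j%:R :> R by rewrite ler0n.
case: j k0 => [|j] k0; rewrite /prefix_odd /prefix_even /path_formula ?addnS ?addSn ?addn0 ?F_S -!natr1 ?natrD.
  by field; nonzero.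
rewrite -natr1 in k0; have := ler0n R j => j0.
by field; nonzero.
Qed.

Lemma prefix_even_rec b j : prefix_even b j = prefix_odd b j + prefix_odd b j +
  (if j is j'.+1 then prefix_even b j' - path_formula b.+1 b.+1 j' else 0).
Proof.
have u0 : 0 <= b%:R :> R by rewrite ler0n.
case: j => [|j]; rewrite /prefix_odd /prefix_even /path_formula ?addnS ?addSn ?addn0 ?F_S -!natr1 ?natrD.
  by field; nonzero.
have := ler0n R j => j0.
by field; nonzero.
Qed.

Lemma prefix_odd0 j : prefix_odd 0 j = 1.
Proof.
have j0 := ler0n R j.
rewrite /prefix_odd !add0n F_S fact0; field; nonzero.
Qed.

Lemma npositiveR l k :
  (npositive l k)%:R = (nprefixes l k)%:R - (npaths l 0 k)%:R :> R.
Proof. by rewrite npositiveE natrD addrK. Qed.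

Lemma npaths0E u k : (npaths (u.+1 + u.+1 + k)%N 0 k)%:R = path_formula u.+1 u.+1 k.
Proof. by rewrite -(npathsE (erefl _)) // subnn. Qed.

(** Both parities go together, as an up or down step changes the parity of their number. If it is
    odd the height is positive; if it is even, the paths ending at 0 are subtracted before a down or
    double step. *)
Lemma nprefixesE l b j :
  (l = (b + b + j)%N.+1 -> (nprefixes l j)%:R = prefix_odd b j) /\
  (l = (b + b + j)%N.+2 -> (nprefixes l j)%:R = prefix_even b j).
Proof.
elim: l b j => // l IHl b j; split=> -[El]; rewrite nprefixesS !natrD.
  case: b El => [|b] El.
    have {El} El : l = j by lia.
    subst l; have [-> ->] := nprefixes_flat j; rewrite prefix_odd0 addr0.
    case: j IHl => [|j] IHl; first by rewrite addr0.
    rewrite npositiveR (proj1 (IHl 0%N j)) // prefix_odd0 npaths_odd ?subr0 ?add0r //.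
    by lia.
  rewrite npositiveR (proj2 (IHl b j)); last by lia.
  have -> : (npaths l 0 j)%:R = path_formula b.+1 b.+1 j.
    by rewrite -npaths0E; congr ((npaths _ _ _)%:R); lia.
  rewrite prefix_odd_rec; congr (_ + _ + _); case: j El => // j El.
  rewrite npositiveR (proj1 (IHl b.+1 j)); last by lia.
  by rewrite npaths_odd ?subr0 //; lia.
rewrite npositiveR (proj1 (IHl b j) El) npaths_odd; last by lia.
rewrite subr0 prefix_even_rec; congr (_ + _); case: j El => // j El.
rewrite npositiveR (proj2 (IHl b j)); last by lia.
by rewrite (_ : l = b.+1 + b.+1 + j)%N ?npaths0E //; lia.
Qed.

End ClosedForms.
End PathCounts.

(** * Symmetric words and the fixed points of evacuation *)

Section Symmetric.
Local Open Scope nat_scope.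
Notation letter := (bool * bool)%type.

Definition nsym l k : nat :=
  count (fun w => Inc_word k w && (map swap (rev w) == w)) (words l).

Lemma swap_rev_cat w1 w2 : map swap (rev (w1 ++ w2)) =
  map swap (rev w2) ++ map swap (rev w1).
Proof. by rewrite rev_cat map_cat. Qed.

Lemma swap_revK w : map swap (rev (map swap (rev w))) = w.
Proof. by rewrite -map_rev revK (mapK swapK). Qed.

Lemma doubles_cat w1 w2 : doubles (w1 ++ w2) = doubles w1 + doubles w2.
Proof. exact: count_cat. Qed.

Lemma doubles_cons w : doubles ((true, true) :: w) = (doubles w).+1.
Proof. by []. Qed.

Lemma size_swap_rev w : size (map swap (rev w)) = size w.
Proof. by rewrite size_map size_rev. Qed.

Lemma all_swap_rev w : all (fun x : letter => x.1 || x.2) (map swap (rev w)) =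
  all (fun x => x.1 || x.2) w.
Proof.
by rewrite all_map all_rev; apply: eq_all => x /=; rewrite orbC.
Qed.

(** Since words start with the largest value, [drop l w] is the first half of the path. It may end
    at any height: the mirrored half leads back to 0. *)
Lemma nsym_even l k : nsym (l + l) (k + k) = nprefixes l k.
Proof.
apply/esym.
apply: (@count_bij _ _ _ _ _ _ (fun v => map swap (rev v) ++ v) (drop l));
  rewrite ?uniq_words //.
  move=> v; rewrite !mem_words => /andP[/eqP sz all_v] /andP[rv /eqP dv].
  rewrite size_cat all_cat size_swap_rev all_swap_rev sz all_v eqxx.
  rewrite swap_rev_cat swap_revK eqxx andbT drop_size_cat ?size_swap_rev //.
  split=> //; rewrite /Inc_word run_cat.
  case E: (run v 0) rv => [h|] //= _; rewrite (run_rev E) eqxx /=.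
  by rewrite doubles_cat doubles_rev dv eqxx.
move=> w; rewrite !mem_words => /andP[/eqP sz all_w] /andP[/andP[/eqP rw /eqP dw] /eqP sw].
have szd : size (drop l w) = l by rewrite size_drop sz addnK.
have szt : size (take l w) = l by rewrite size_take sz; case: ifP => //; lia.
have E : take l w = map swap (rev (drop l w)).
  move: sw; rewrite -{1 2}(cat_take_drop l w) swap_rev_cat => /eqP.
  by rewrite eqseq_cat ?size_swap_rev ?szd ?szt // => /andP[/eqP-> _].
have Ew : w = map swap (rev (drop l w)) ++ drop l w by rewrite -E cat_take_drop.
rewrite szd eqxx -Ew /=; split=> //.
  by move: all_w; rewrite {1}Ew all_cat => /andP[].
move: rw dw; rewrite {1 2}Ew run_cat.
case: (run (drop l w) 0) => //= h _.
by rewrite doubles_cat doubles_rev => dd; apply/eqP; lia.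
Qed.

(** The middle letter equals its own swap, hence is double, and therefore needs positive height. *)
Lemma nsym_odd l k : nsym (l + l).+1 (k + k).+1 = npositive l k.
Proof.
apply/esym.
apply: (@count_bij _ _ _ _ _ _ (fun v => map swap (rev v) ++ (true, true) :: v)
  (drop l.+1)); rewrite ?uniq_words //.
  move=> v; rewrite !mem_words => /andP[/eqP sz all_v] /andP[rv /eqP dv].
  rewrite size_cat all_cat size_swap_rev all_swap_rev /= sz all_v addnS eqxx.
  rewrite swap_rev_cat rev_cons map_rcons swap_revK cat_rcons eqxx andbT.
  rewrite -cat_rcons drop_size_cat ?size_rcons ?size_swap_rev ?sz //.
  split=> //; rewrite /Inc_word cat_rcons run_cat.
  case E: (run v 0) rv => [[|h]|] //= _; rewrite -/(run v 0) E /= (run_rev E) eqxx /=.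
  by rewrite doubles_cat doubles_rev doubles_cons dv addnS eqxx.
move=> w; rewrite !mem_words => /andP[/eqP sz all_w] /andP[/andP[/eqP rw /eqP dw] /eqP sw].
have szd : size (drop l.+1 w) = l by rewrite size_drop sz; lia.
have szt : size (take l w) = l by rewrite size_take sz; case: ifP => //; lia.
have [x Ed] : exists x, drop l w = x :: drop l.+1 w.
  exists (nth (true, true) w l); apply: drop_nth; lia.
have E : [/\ take l w = map swap (rev (drop l.+1 w)) & swap x = x].
  move: sw; rewrite -{1 2}(cat_take_drop l w) Ed swap_rev_cat rev_cons map_rcons.
  rewrite cat_rcons => /eqP; rewrite eqseq_cat ?size_swap_rev ?szd ?szt //.
  by rewrite eqseq_cons => /and3P[/eqP-> /eqP-> _].
have {E} [E Ex] := E.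
have Ew : w = map swap (rev (drop l.+1 w)) ++ x :: drop l.+1 w.
  by rewrite -E -Ed cat_take_drop.
have all_w' := all_w; rewrite Ew all_cat /= in all_w'.
case/and3P: all_w' => _ x_in all_d.
have {Ex x_in} Ex : x = (true, true).
  by case: x Ex x_in {Ed Ew} => [[] []].
subst x; rewrite szd eqxx all_d -Ew; split=> //.
move: rw dw; rewrite {1 2}Ew run_cat /= -/(run _ 0).
case: (run (drop l.+1 w) 0) => [[|h]|] //= _.
by rewrite doubles_cat doubles_rev doubles_cons => dd; apply/eqP; lia.
Qed.

Lemma mem_fixed_points (A : choiceType) (X : {fset A}) (c : A -> A) x :
  (x \in fixed_points X c) = (x \in X) && (c x == x).
Proof. by rewrite !inE. Qed.

Section Card.
Variables (n k : nat).
Hypotheses (n_gt0 : 0 < n) (le_kn : k <= n).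

Lemma card_Inc_words : #|` Inc [:: n; n] k| = npaths (2 * n - k) 0 k.
Proof.
rewrite -[LHS]count_predT; apply: (@count_bij _ _ _ _ _ _ (@word n) (@tableau_of n)).
- exact: fset_uniq.
- exact: uniq_words.
- by move=> T; rewrite mem_Inc => T_in _; have [A B C] := wordP n_gt0 le_kn T_in; split.
- move=> w w_in Iw; rewrite mem_Inc.
  by have [] := tableau_ofP n_gt0 le_kn w_in Iw.
Qed.

Lemma Kevacuation_Inc (T : filling [:: n; n]) : T \in Inc [:: n; n] k ->
  Kevacuation T = rotate T.
Proof. by rewrite mem_Inc => /is_IncP[tT _]; apply: KevacuationE. Qed.

Lemma card_fixed_words :
  #|` fixed_points (Inc [:: n; n] k) (@Kevacuation [:: n; n])| = nsym (2 * n - k) k.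
Proof.
rewrite -[LHS]count_predT; apply: (@count_bij _ _ _ _ _ _ (@word n) (@tableau_of n)).
- exact: fset_uniq.
- exact: uniq_words.
- move=> T; rewrite mem_fixed_points => /andP[T_in /eqP]; rewrite Kevacuation_Inc // => rT _.
  rewrite mem_Inc in T_in; have [w_in Iw wK] := wordP n_gt0 le_kn T_in.
  have [_ _ wr] := rotateP n_gt0 le_kn T_in.
  by rewrite w_in Iw -wr rT eqxx.
- move=> w w_in /andP[Iw /eqP sw].
  have [T_in TK] := tableau_ofP n_gt0 le_kn w_in Iw.
  rewrite -mem_Inc in T_in; rewrite mem_fixed_points T_in TK Kevacuation_Inc //=; split=> //.
  rewrite mem_Inc in T_in; have [rT_in _ wr] := rotateP n_gt0 le_kn T_in.
  have [_ _ <-] := wordP n_gt0 le_kn rT_in.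
  by rewrite wr TK sw eqxx.
Qed.
End Card.
End Symmetric.

(** * Both cardinalities as quotients of factorials *)

Section Formulas.

Section RealField.
Variable R : realFieldType.
Local Notation F m := (m%N`!%:R : R).

Lemma npaths_formula u k :
  (npaths (u.+1 + u.+1 + k)%N 0 k)%:R * (F k * F u.+1 * (F u * F (u + k).+2)) =
  F (u + k)%N * F (u + u + k).+2 :> R.
Proof.
have u0 := ler0n R u; have k0 := ler0n R k.
rewrite npaths0E /path_formula ?addnS ?addSn !(factS, natrM) -!natr1 !natrD.
by field; nonzero.
Qed.

Lemma prefix_odd_formula b j :
  prefix_odd R b j * (F j * F b * (F b * F (b + j).+1)) =
  F (b + j)%N * F (b + b + j).+1.
Proof.
have b0 := ler0n R b; have j0 := ler0n R j.
rewrite /prefix_odd !(factS, natrM) -!natr1 !natrD.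
by field; nonzero.
Qed.

Lemma prefix_even_formula b j :
  prefix_even R b j * (F j * F b.+1 * (F b * F (b + j).+1)) =
  F (b + j)%N * F (b + b + j).+2.
Proof.
have b0 := ler0n R b; have j0 := ler0n R j.
rewrite /prefix_even !(factS, natrM) -!natr1 !natrD.
by field; nonzero.
Qed.

Lemma prefix_even_sub_formula b j :
  (prefix_even R b j - path_formula R b.+1 b.+1 j) * (F j * F b.+1 * (F b * F (b + j).+2)) =
  F (b + j).+1 * F (b + b + j).+2.
Proof.
have b0 := ler0n R b; have j0 := ler0n R j.
rewrite /prefix_even /path_formula ?addnS ?addSn !(factS, natrM) -!natr1 !natrD.
by field; nonzero.
Qed.

End RealField.

Lemma natr_formula (x a b c d e f : nat) :
  x%:R * (a%:R * b%:R * (c%:R * d%:R)) = e%:R * f%:R :> rat ->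
  (x * (a * b * (c * d)) = e * f)%N.
Proof. by rewrite -!natrM => /eqP; rewrite eqr_nat => /eqP. Qed.

Local Open Scope nat_scope.
Variables (n k : nat).
Hypothesis lt_kn : k < n.

Lemma card_Inc_formula :
  #|` Inc [:: n; n] k| * (k`! * (n - k)`! * ((n - k).-1`! * n.+1`!)) =
  n.-1`! * (2 * n - k)`!.
Proof.
rewrite card_Inc_words; [|lia|lia]; have [u Eu] : exists u, n = u.+1 + k.
  by exists (n - k).-1; lia.
have -> : 2 * n - k = u.+1 + u.+1 + k by lia.
have -> : n - k = u.+1 by lia.
rewrite [u.+1.-1]/=.
have -> : n.+1 = (u + k).+2 by lia.
have -> : n.-1 = u + k by lia.
apply: natr_formula; rewrite npaths_formula.
by rewrite addnS !addSn.
Qed.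

(** The identity [card_Inc_formula] with all arguments of factorials halved, which is the form that
    [qfact_half] yields at -1. *)
Lemma card_fixed_formula :
  #|` fixed_points (Inc [:: n; n] k) (@Kevacuation [:: n; n])| *
    (k./2`! * (n - k)./2`! * ((n - k).-1./2`! * n.+1./2`!)) =
  n.-1./2`! * (2 * n - k)./2`!.
Proof.
rewrite card_fixed_words; [|lia|lia].
set b := (n - k).-1./2; set j := k./2.
have Ek := odd_double_half k; rewrite -/j in Ek.
have Ea := odd_double_half (n - k).-1; rewrite -/b in Ea.
apply: natr_formula.
(* The parity of [k] decides whether there is a middle letter. Half of a symmetric word has [n - k]
   up and down steps, whose parity selects [prefix_odd] or [prefix_even]. *)
case: (odd k) Ek => Ek; case: (odd (n - k).-1) Ea => Ea.
- have -> : 2 * n - k = ((b + b + j).+2 + (b + b + j).+2).+1 by lia.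
  have {1}-> : k = (j + j).+1 by lia.
  have -> : (n - k)./2 = b.+1 by lia.
  have -> : n.+1./2 = (b + j).+2 by lia.
  have -> : n.-1./2 = (b + j).+1 by lia.
  rewrite nsym_odd npositiveR (proj2 (nprefixesE _ _ b j)) //.
  rewrite (_ : (b + b + j).+2 = b.+1 + b.+1 + j); last by lia.
  rewrite npaths0E prefix_even_sub_formula.
  by congr (_ * (_`!)%:R)%R; lia.
- have -> : 2 * n - k = ((b + b + j).+1 + (b + b + j).+1).+1 by lia.
  have {1}-> : k = (j + j).+1 by lia.
  have -> : (n - k)./2 = b by lia.
  have -> : n.+1./2 = (b + j).+1 by lia.
  have -> : n.-1./2 = b + j by lia.
  rewrite nsym_odd npositiveR (proj1 (nprefixesE _ _ b j)) //.
  rewrite npaths_odd ?subr0; last by lia.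
  rewrite prefix_odd_formula.
  by congr (_ * (_`!)%:R)%R; lia.
- have -> : 2 * n - k = (b + b + j).+2 + (b + b + j).+2 by lia.
  have {1}-> : k = j + j by lia.
  have -> : (n - k)./2 = b.+1 by lia.
  have -> : n.+1./2 = (b + j).+1 by lia.
  have -> : n.-1./2 = b + j by lia.
  rewrite nsym_even (proj2 (nprefixesE _ _ b j)) // prefix_even_formula.
  by congr (_ * (_`!)%:R)%R; lia.
- have -> : 2 * n - k = (b + b + j).+1 + (b + b + j).+1 by lia.
  have {1}-> : k = j + j by lia.
  have -> : (n - k)./2 = b by lia.
  have -> : n.+1./2 = (b + j).+1 by lia.
  have -> : n.-1./2 = b + j by lia.
  rewrite nsym_even (proj1 (nprefixesE _ _ b j)) // prefix_odd_formula.
  by congr (_ * (_`!)%:R)%R; lia.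
Qed.

End Formulas.

(** * The values of f at 1 and -1 *)

Section QValues.
Local Notation "p %:F" := (tofrac p).

Lemma qfactS m : qfact m.+1 = qfact m * qint m.+1.
Proof. by rewrite /qfact big_nat_recr. Qed.

Lemma horner_qint1 m : (qint m).[1] = m%:R.
Proof.
rewrite /qint horner_sum (eq_bigr (fun=> 1)) => [|i _]; last first.
  by rewrite hornerXn expr1n.
by rewrite sumr_const card_ord.
Qed.

Lemma horner_qfact1 m : (qfact m).[1] = m`!%:R.
Proof.
elim: m => [|m IHm]; first by rewrite /qfact big_geq // hornerC.
by rewrite qfactS hornerM IHm horner_qint1 -natrM mulnC.
Qed.

Lemma qintSS m : qint m.+2 = qint m + 'X^m * (1 + 'X).
Proof. by rewrite /qint !big_ord_recr /= -addrA mulrDr mulr1 -exprSr. Qed.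

Lemma qint_double m : exists2 g, qint m.*2 = (1 + 'X) * g & g.[-1] = m%:R.
Proof.
elim: m => [|m [g Eg gv]].
  by exists 0; rewrite ?horner0 // mulr0 /qint big_ord0.
exists (g + 'X^(m.*2)).
  by rewrite doubleS qintSS Eg [RHS]mulrDr; congr (_ + _); apply: mulrC.
by rewrite hornerD hornerXn gv -mul2n exprM sqrrN !expr1n natr1.
Qed.

Lemma qint_odd m : (qint m.*2.+1).[-1] = 1.
Proof.
elim: m => [|m IHm]; first by rewrite /qint big_ord1 expr0 hornerC.
by rewrite doubleS qintSS hornerD IHm hornerM hornerD hornerC hornerX subrr mulr0 addr0.
Qed.

(** Among the factors of the q-factorial, each even [qint i.*2] gives one factor [1 + 'X] with
    cofactor [i] at -1, and each odd one takes the value 1 there. *)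
Lemma qfact_half m :
  exists2 g, qfact m = (1 + 'X) ^+ m./2 * g & g.[-1] = m./2`!%:R.
Proof.
elim: m => [|m [g Eg gv]].
  by exists 1; rewrite ?hornerC // mulr1 /qfact big_geq.
have Em := odd_double_half m.+1; move: Em; rewrite /= uphalf_half.
case: (odd m) => /= Em.
  have [g' Eg' gv'] := qint_double (m./2).+1.
  exists (g * g'); last by rewrite hornerM gv gv' -natrM add1n factS mulnC.
  by rewrite qfactS Eg -Em add1n add0n Eg' exprSr mulrACA.
exists (g * qint m.+1).
  by rewrite qfactS Eg mulrA.
by rewrite hornerM gv -Em add0n add1n qint_odd mulr1.
Qed.

Lemma has_value_cancel (c p d N D : {poly algC}) x :
  N = c * p -> D = c * d -> c != 0 -> d.[x] != 0 ->
  has_value (N%:F / D%:F) x (p.[x] / d.[x]).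
Proof.
move=> -> -> c0 d0; exists p, d; split=> //.
rewrite !rmorphM /= invfM mulrACA divff ?mul1r //.
by rewrite tofrac_eq0.
Qed.

Lemma mulf_rearrange (K : fieldType) (a b c d e f : K) :
  a / (b * c) * (d / (c * e)) / f = a * d / (b * (c * f) * (c * e)).
Proof. by rewrite !invfM; ring. Qed.

(** Both q-binomials have [qfact (n - k).-1] in the denominator; one of the two absorbs the division
    by [qint (n - k)]. *)
Lemma fnkE n k : (k < n)%N -> fnk n k =
  (qfact n.-1 * qfact (2 * n - k))%:F /
  (qfact k * qfact (n - k) * (qfact (n - k).-1 * qfact n.+1))%:F.
Proof.
move=> lt_kn; rewrite /fnk /qbinom.
have -> : (n - 1)%N = n.-1 by lia.
have -> : (n.-1 - k)%N = (n - k).-1 by lia.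
have -> : (n - k - 1)%N = (n - k).-1 by lia.
have -> : (2 * n - k - (n - k).-1)%N = n.+1 by lia.
have -> : qfact (n - k) = qfact (n - k).-1 * qint (n - k).
  by rewrite -{1 3}(@prednK (n - k)) ?qfactS //; lia.
by rewrite !rmorphM /=; apply: mulf_rearrange.
Qed.

Lemma natr_div_eq (a b c : nat) : (a * b = c)%N -> (b != 0)%N ->
  a%:R = c%:R / b%:R :> algC.
Proof. by move=> <- b0; rewrite natrM mulfK // pnatr_eq0. Qed.

Lemma fact4_neq0 a b c d : (a`! * b`! * (c`! * d`!) != 0)%N.
Proof. by rewrite -lt0n !muln_gt0 !fact_gt0. Qed.

Lemma has_value_fnk1 n k : (k < n)%N ->
  has_value (fnk n k) 1 #|` Inc [:: n; n] k|%:R.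
Proof.
move=> lt_kn; rewrite fnkE //.
have := card_Inc_formula lt_kn => /natr_div_eq ->; last first.
  exact: fact4_neq0.
set N := qfact n.-1 * _; set D := qfact k * _ * _.
have -> : (n.-1`! * (2 * n - k)`!)%:R = N.[1].
  by rewrite /N hornerM !horner_qfact1 -natrM.
have -> : (k`! * (n - k)`! * ((n - k).-1`! * n.+1`!))%:R = D.[1].
  by rewrite /D !hornerM !horner_qfact1 -!natrM.
apply: (@has_value_cancel 1); rewrite ?mul1r ?oner_eq0 //.
by rewrite /D !hornerM !horner_qfact1 -!natrM pnatr_eq0 fact4_neq0.
Qed.

Lemma has_value_fnkN1 n k : (k < n)%N -> has_value (fnk n k) (-1)
  #|` fixed_points (Inc [:: n; n] k) (@Kevacuation [:: n; n])|%:R.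
Proof.
move=> lt_kn; rewrite fnkE //.
have := card_fixed_formula lt_kn => /natr_div_eq ->; last first.
  exact: fact4_neq0.
have [g1 E1 v1] := qfact_half n.-1; have [g2 E2 v2] := qfact_half (2 * n - k).
have [g3 E3 v3] := qfact_half k; have [g4 E4 v4] := qfact_half (n - k).
have [g5 E5 v5] := qfact_half (n - k).-1; have [g6 E6 v6] := qfact_half n.+1.
rewrite E1 E2 E3 E4 E5 E6.
have -> : (n.-1./2`! * (2 * n - k)./2`!)%:R = (g1 * g2).[-1].
  by rewrite hornerM v1 v2 -natrM.
have -> : (k./2`! * (n - k)./2`! * ((n - k).-1./2`! * n.+1./2`!))%:R =
    (g3 * g4 * (g5 * g6)).[-1].
  by rewrite !hornerM v3 v4 v5 v6 -!natrM.
apply: (@has_value_cancel ((1 + 'X) ^+ (n.-1./2 + (2 * n - k)./2))).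
- by rewrite exprD mulrACA.
(* Equal exponents: [(n - k)./2 + (n - k).-1./2 = n - k - 1], [n.+1./2 = n.-1./2 + 1] and
   [(2 * n - k)./2 = n - k + k./2]. *)
- have -> : (n.-1./2 + (2 * n - k)./2 = k./2 + (n - k)./2 + ((n - k).-1./2 + n.+1./2))%N.
    by lia.
  by rewrite !exprD (mulrACA _ g3) (mulrACA _ g5) [LHS]mulrACA.
- rewrite expf_neq0 //; apply/eqP => /(congr1 (fun p : {poly algC} => p.[0]))/eqP.
  by rewrite hornerD hornerC hornerX addr0 horner0 oner_eq0.
- by rewrite !hornerM v3 v4 v5 v6 -!natrM pnatr_eq0 fact4_neq0.
Qed.

End QValues.

Theorem theorem1p2 (n k : nat) (hn : (1 <= n)%N) (hk : (k <= n - 1)%N) :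
  [/\ cyclic_sieving (Inc [:: n; n] k) 2 (@Kevacuation [:: n; n]) (fnk n k),
      has_value (fnk n k) 1 (#|` Inc [:: n; n] k|%:R)
    & has_value (fnk n k) (-1)
        (#|` fixed_points (Inc [:: n; n] k) (@Kevacuation [:: n; n])|%:R)].
Proof.
have lt_kn : (k < n)%N by lia.
have v1 := has_value_fnk1 lt_kn; have vN1 := has_value_fnkN1 lt_kn.
split=> //; split.
- move=> T T_in; rewrite (Kevacuation_Inc hn T_in); rewrite mem_Inc in T_in.
  by have [rT_in _ _] := rotateP hn (ltnW lt_kn) T_in; rewrite mem_Inc.
- move=> T T_in; rewrite /= (Kevacuation_Inc hn T_in); rewrite mem_Inc in T_in.
  have [rT_in rK _] := rotateP hn (ltnW lt_kn) T_in.
  by rewrite (@Kevacuation_Inc n k hn) // mem_Inc.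
move=> z m z_prim.
have -> : z = -1.
  have := prim_expr_order z_prim => /eqP; rewrite sqrf_eq1 => /orP[/eqP z1|/eqP //].
  by have := prim_order_dvd z_prim 1; rewrite z1 expr1n eqxx.
have zE : (-1 : algC) ^ m = (-1) ^ (m %% 2)%Z.
  rewrite {1}(divz_eq m 2) [(m %/ 2)%Z * 2]mulrC expfzDr ?oppr_eq0 ?oner_eq0 //.
  by rewrite -exprz_exp -exprnP sqrrN expr1n exp1rz mul1r.
have := modz_ge0 m (isT : (2 : int) != 0); have := ltz_pmod m (isT : 0 < (2 : int)).
rewrite zE; case: (m %% 2)%Z => [[|[|r]]|r] // _ _.
  rewrite expr0z /=; suff -> : fixed_points (Inc [:: n; n] k) id = Inc [:: n; n] k by [].
  by apply/fsetP => T; rewrite mem_fixed_points eqxx andbT.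
Qed.
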